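(* The permutation defect fusion ring $(C^\times_{S_n},\otimes)$ is a unital based $\mathbb{Z}_+$-ring (with respect to the basis consisting of the multilayer anyons $\vec a$ and the defects $X^\sigma_{\vec a}$) which is $S_n$-crossed commutative, i.e. $X^\rho_{\vec a}\otimes Y=\rho\cdot Y\otimes X^\rho_{\vec a}$ for all $\rho\in S_n$, all basis elements $X^\rho_{\vec a}\in C_\rho$ and all $Y\in C^\times_{S_n}$.
   Context: Let $\mathcal{C}$ be a modular tensor category, $\mathrm{Irr}(\mathcal{C})$ its finite set of isomorphism classes of simple objects (containing $1$), $a\mapsto a^*$ duality, $N_{ab}^c$ fusion coefficients, and $C$ its fusion ring (free $\mathbb{Z}$-module on $\mathrm{Irr}(\mathcal{C})$, product $a\otimes b=\sum_cN_{ab}^cc$). Fix $n\ge 2$. $C^{\boxtimes n}=C^{\otimes_{\mathbb{Z}}n}$ has basis the multilayer anyons $\vec a=a_1\boxtimes\cdots\boxtimes a_n$ ($a_i\in\mathrm{Irr}(\mathcal{C})$, the entry of layer $i$), layerwise product, unit $\vec 1$. $S_n$ acts by permuting layers ($\rho$ moves layer $i$ to layer $\rho(i)$); permutations compose right to left. For $\sigma\in S_n$ let $\mathcal{O}(\sigma)$ be its orbits (cycles incl. fixed points); $\vec a$ is $\sigma$-fixed iff $a_i=a_j$ whenever $i,j$ share an orbit. $C_\sigma$ is the free $\mathbb{Z}$-module on symbols $X^\sigma_{\vec a}$ ($\vec a$ $\sigma$-fixed), identified with $R_\sigma=\bigotimes_{O\in\mathcal{O}(\sigma)}C$ via $X^\sigma_{\vec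 a}\leftrightarrow\bigotimes_Oa_O$; write $X^\sigma_r$ for $r\in R_\sigma$. $C_{\mathrm{id}}=C^{\boxtimes n}$, $X^{\mathrm{id}}_{\vec a}=\vec a$, $C^\times_{S_n}=\bigoplus_\sigma C_\sigma$. $S_n$ acts on $C^\times_{S_n}$ by $\rho\cdot X^\sigma_{\vec a}=X^{\rho\sigma\rho^{-1}}_{\rho\cdot\vec a}$. Confinement: $c_\sigma:C^{\boxtimes n}\to R_\sigma$ linear with $c_\sigma(\vec a)=\bigotimes_O(\bigotimes_{k\in O}a_k)$. Anyon–defect fusion: $\vec a\otimes X^\sigma_{\vec b}=X^\sigma_{\vec b}\otimes\vec a:=X^\sigma_{c_\sigma(\vec a)\cdot\vec b}$. A $\sigma$-deconfinement $d_\sigma(\vec b)$ is any $d\in C^{\boxtimes n}$ with nonnegative coefficients and $d\otimes X^\sigma_{\vec 1}=X^\sigma_{\vec b}$. For a transposition $t=(ij)$, $\Omega_t=\sum_{c\in\mathrm{Irr}(\mathcal{C})}\vec e_c$ with $\vec e_c$ having $c$ in layer $i$, $c^*$ in layer $j$, $1$ elsewhere. Following the paper's algorithm, $F(\rho,\sigma)$: write $\rho=t_1\cdots t_m$ with each disjoint cycle $(i_1\cdots i_l)$ of $\rho$ written as $(i_1i_2)(i_2i_3)\cdots(i_{l-1}i_l)$; $\pi_{m+1}=\sigma$, $\pi_k=t_k\pi_{k+1}$; $F(\rho,\sigma)=\prod\Omega_{t_k}$ over $k$ with both indices of $t_k$ in a common cycle of $\pi_{k+1}$. The product $\otimes$ on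 $C^\times_{S_n}$ is bilinear with $X^\rho_{\vec a}\otimes X^\sigma_{\vec b}:=(d_\rho(\vec a)\otimes d_\sigma(\vec b)\otimes F(\rho,\sigma))\otimes X^{\rho\sigma}_{\vec 1}$. A unital based $\mathbb{Z}_+$-ring is a ring, free as $\mathbb{Z}$-module, with a fixed basis $\{b_i\}_{i\in I}$ such that $b_ib_j=\sum_kN_{ij}^kb_k$ with $N_{ij}^k\in\mathbb{Z}_{\ge0}$, $1$ is a basis element, and there is an involution $i\mapsto i^*$ of $I$ inducing an anti-involution of the ring such that the coefficient of $1$ in $b_ib_j$ is $1$ if $i=j^*$ and $0$ otherwise. *)

(* Defs.v *)
From HB Require Import structures.
From mathcomp Require Import all_boot all_order all_fingroup all_algebra.
Set Implicit Arguments. Unset Strict Implicit. Unset Printing Implicit Defensive.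
Import GRing.Theory.
Local Open Scope ring_scope.

Section PermDefectFusion.

(* Fusion data of the modular tensor category:  I = Irr(C), one = 1,
   dual = duality, N a b c = N_{ab}^c. *)
Variables (I : finType) (one : I) (dual : I -> I) (N : I -> I -> I -> nat).

Definition mtc_fusion_rules : Prop :=
  (forall a, dual (dual a) = a) /\
      (forall a c, N one a c = (a == c) :> nat) /\
      (forall a b c, N a b c = N b a c) /\
      (forall a b c d, (\sum_(e : I) N a b e * N e c d = \sum_(e : I) N b c e * N a e d)%N) /\
      (forall a b, N a b one = (b == dual a) :> nat) /\
      (forall a b c, N a b c = N (dual a) c b) /\
    (forall a b c, N a b c = N (dual b) (dual a) (dual c)).

Variable n : nat.

(* multilayer labels: entry of layer i *)
Local Notation T := {ffun 'I_n -> I}.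
(* elements of C^{boxtimes n} (and of R_sigma, represented by their
   coefficients on sigma-fixed labels) *)
Local Notation A := {ffun T -> int}.

Definition vec1 : T := [ffun _ => one].
Definition deltaA (b : T) : A := [ffun a : T => (a == b)%:Z].

Definition mulA (x y : A) : A :=
  [ffun c : T => \sum_(a : T) \sum_(b : T) x a * y b * (\prod_(i < n) N (a i) (b i) (c i))%:Z].

(* composition, right to left:  pcomp r s = r o s *)
Definition pcomp (r s : {perm 'I_n}) : {perm 'I_n} := (s * r)%g.

(* rho moves layer i to layer rho(i) *)
Definition permT (r : {perm 'I_n}) (a : T) : T := [ffun j => a ((r^-1)%g j)].

Definition fixedb (s : {perm 'I_n}) (a : T) : bool := [forall i, a (s i) == a i].

(* the value a_O of a fixed label on an orbit O *)
Definition orbval (b : T) (O : {set 'I_n}) : I := oapp b one [pick k in O].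

Fixpoint Nseq (s : seq I) (c : I) : nat :=
  match s with
  | [::] => (c == one)
  | x :: s' => (\sum_(e : I) N x e c * Nseq s' e)%N
  end.

Definition conf (s : {perm 'I_n}) (x : A) : A :=
  [ffun b : T => if fixedb s b then
     \sum_(a : T) x a * (\prod_(O in porbits s) Nseq [seq a k | k <- enum O] (orbval b O))%:Z
   else 0].

(* product in R_sigma = tensor over orbits of C *)
Definition mulR (s : {perm 'I_n}) (r t : A) : A :=
  [ffun c : T => if fixedb s c then
     \sum_(e : T | fixedb s e) \sum_(f : T | fixedb s f)
        r e * t f * (\prod_(O in porbits s) N (orbval e O) (orbval f O) (orbval c O))%:Z
   else 0].

(* anyon-defect fusion:  x (x) X^sigma_r = X^sigma_{c_sigma(x) r} *)
Definition actAD (s : {perm 'I_n}) (x r : A) : A := mulR s (conf s x) r.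

Definition isDeconf (s : {perm 'I_n}) (b : T) (d : A) : Prop :=
  (forall a, 0 <= d a) /\ actAD s d (deltaA vec1) = deltaA b.

Definition omega (i j : 'I_n) : A :=
  [ffun a : T => \sum_(c : I)
     (a == [ffun k => if k == i then c else if k == j then dual c else one])%:Z].

(* decomposition rho = t_1 ... t_m : each cycle written starting at its
   least element i1 with i_{k+1} = rho(i_k), as (i1 i2)(i2 i3)...(i_{l-1} i_l);
   cycles listed by increasing least element *)
Definition cycle_min (r : {perm 'I_n}) (k : 'I_n) : bool :=
  [forall j in porbit r k, (k <= j)%N].
Definition tlist (r : {perm 'I_n}) : seq ('I_n * 'I_n) :=
  flatten [seq [seq (((r ^+ j)%g k), ((r ^+ j.+1)%g k)) | j <- iota 0 (#|porbit r k|).-1]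
          | k <- enum 'I_n & cycle_min r k].

Definition Fstep (t : 'I_n * 'I_n) (acc : A * {perm 'I_n}) : A * {perm 'I_n} :=
  let: (x, p) := acc in
  ((if t.2 \in porbit p t.1 then mulA (omega t.1 t.2) x else x),
   pcomp (tperm t.1 t.2) p).
Definition Ffac (r s : {perm 'I_n}) : A :=
  (foldr Fstep (deltaA vec1, s) (tlist r)).1.

(* basis of C^x_{S_n}: defects X^sigma_a with a sigma-fixed (sigma = id: anyons) *)
Definition B := {x : {perm 'I_n} * T | fixedb x.1 x.2}.
(* elements of C^x_{S_n}: integer coefficient vectors on the basis *)
Definition V := {ffun B -> int}.

Definition bv (x : B) : V := [ffun y => (y == x)%:Z].
Definition coef (v : V) (p : {perm 'I_n} * T) : int :=
  if insub p is Some x then v x else 0.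
Definition embed (s : {perm 'I_n}) (z : A) : V :=
  [ffun u : B => if (val u).1 == s then z (val u).2 else 0].

Definition deconf_choice (D : {perm 'I_n} -> T -> A) : Prop :=
  forall s b, fixedb s b -> isDeconf s b (D s b).

Definition mulB (D : {perm 'I_n} -> T -> A) (x y : B) : V :=
  let r := (val x).1 in let a := (val x).2 in
  let s := (val y).1 in let b := (val y).2 in
  let p := pcomp r s in
  embed p (actAD p (mulA (mulA (D r a) (D s b)) (Ffac r s)) (deltaA vec1)).

Definition mulV (D : {perm 'I_n} -> T -> A) (u v : V) : V :=
  \sum_(x : B) \sum_(y : B) (mulB D x y) *~ (u x * v y).

(* S_n-action: rho . X^sigma_a = X^{rho sigma rho^-1}_{rho . a} *)
Definition actV (r : {perm 'I_n}) (v : V) : V :=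
  [ffun u : B => coef v (pcomp (r^-1)%g (pcomp (val u).1 r), permT (r^-1)%g (val u).2)].

(* linear map induced by an involution of the basis *)
Definition starV (st : B -> B) (v : V) : V := [ffun x => v (st x)].

End PermDefectFusion.

(* Main.v *)
(* Write A for the n-fold tensor power of the fusion ring C, with the pairing
   <x, y> = coefficient of 1 in x y^*, for which the basis is orthonormal.
   For a permutation s let psi_s : A -> C^{(x) orbits} multiply the layers of
   each orbit, and let E_s in A be the adjoint of psi_s applied to 1.
   Then E_s x = 0 iff psi_s x = 0, so the sector of s is A E_s, the defect
   X^s_b corresponding to E_s d_s(b).

   If i, j lie in distinct orbits of s and t = (i j), then E_{ts} = Omega_t E_s.
   Running the algorithm for F(r,s) with this rule gives
   E_{rs} F(r,s)^2 = E_r E_s, so that G(r,s) = E_{rs} F(r,s), the structure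
   element of the product, satisfies G(r,s)^2 = E_r E_s E_{rs}. All these
   elements are nonnegative on the spectrum of A, where square roots are unique.
   Hence associativity, the unit, duality and crossed commutativity, where the
   last uses E_r x = E_r (r.x), are verified on squares, in which F no longer
   appears. Positivity also shows that G(r,s) y = 0 as soon as E_r y = 0 or
   E_s y = 0, which makes the product independent of the deconfinements. *)
From HB Require Import structures.
From mathcomp Require Import all_boot all_order all_fingroup all_algebra.
From mathcomp Require Import ring zify.
Require Import Defs.
Set Implicit Arguments. Unset Strict Implicit. Unset Printing Implicit Defensive.
Import Order.TTheory GRing.Theory Num.Theory.
Local Open Scope ring_scope.

(** * Fusion rings and their positive elements *)

Section FusionRules.
Variables (I : finType) (one : I) (dual : I -> I) (N : I -> I -> I -> nat).
Hypothesis HN : mtc_fusion_rules one dual N.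

Lemma dualK : involutive dual. Proof. by case: HN. Qed.

Lemma fusion1 a c : N one a c = (a == c) :> nat. Proof. by case: HN => _ []. Qed.

Lemma fusionC a b c : N a b c = N b a c. Proof. by case: HN => _ [_ []]. Qed.

Lemma fusionA a b c d :
  (\sum_e N a b e * N e c d = \sum_e N b c e * N a e d)%N.
Proof. by case: HN => _ [_ [_ []]]. Qed.

Lemma fusion_one a b : N a b one = (b == dual a) :> nat.
Proof. by case: HN => _ [_ [_ [_ []]]]. Qed.

Lemma fusion_adj a b c : N a b c = N (dual a) c b.
Proof. by case: HN => _ [_ [_ [_ [_ []]]]]. Qed.

Lemma fusion_dual a b c : N (dual a) (dual b) (dual c) = N a b c.
Proof. by rewrite (fusionC (dual a)); case: HN => _ [_ [_ [_ [_ [_ <-]]]]]. Qed.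

Lemma dual_one : dual one = one.
Proof.
have := fusion_one one one; rewrite fusion1 eqxx.
by case: eqP => // <-.
Qed.

End FusionRules.

(* An alias of the coefficient vectors, since [{ffun I -> int}] canonically
   carries the pointwise product. *)
Definition fusion_ring (I : finType) (one : I) (dual : I -> I)
  (N : I -> I -> I -> nat) (HN : mtc_fusion_rules one dual N) : Type :=
  {ffun I -> int}.

Identity Coercion ffun_of_fusion_ring : fusion_ring >-> finfun_of.

HB.instance Definition _ I one dual N (HN : @mtc_fusion_rules I one dual N) :=
  GRing.Zmodule.copy (fusion_ring HN) {ffun I -> int}.

Section FusionRing.
Variables (I : finType) (one : I) (dual : I -> I) (N : I -> I -> I -> nat).
Variable HN : mtc_fusion_rules one dual N.
Local Notation R := (fusion_ring HN).

Definition basis (a : I) : R := [ffun x => (x == a)%:Z].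

Definition fusion_mul (x y : R) : R :=
  [ffun c => \sum_a \sum_b x a * y b * (N a b c)%:Z].

Lemma fusion_mulC : commutative fusion_mul.
Proof.
move=> x y; apply/ffunP=> c; rewrite !ffunE exchange_big /=.
by apply: eq_bigr => a _; apply: eq_bigr => b _; rewrite (fusionC HN) [x b * _]mulrC.
Qed.

Lemma fusion_mul1 : left_id (basis one) fusion_mul.
Proof.
move=> x; apply/ffunP=> c; rewrite !ffunE (bigD1 one) //= [X in _ + X]big1 ?addr0; last first.
  by move=> a /negPf na; apply: big1 => b _; rewrite ffunE na !mul0r.
rewrite (bigD1 c) //= big1 ?addr0; last first.
  by move=> b /negPf nb; rewrite (fusion1 HN) nb mulr0.
by rewrite ffunE (fusion1 HN) !eqxx mulr1 mul1r.
Qed.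

Lemma fusion_mulDl : left_distributive fusion_mul +%R.
Proof.
move=> x y z; apply/ffunP=> c; rewrite !ffunE -big_split /=.
apply: eq_bigr => a _; rewrite -big_split /=; apply: eq_bigr => b _.
by rewrite ffunE !mulrDl.
Qed.

Lemma fusion_mulA : associative fusion_mul.
Proof.
move=> x y z; apply/ffunP=> d.
(* Both bracketings are brought to one triple sum over the outer labels, whose inner sum over [e] is
   the right side of [fusionA]. *)
transitivity (\sum_a \sum_b \sum_c
    x a * y b * z c * (\sum_e N b c e * N a e d)%:Z).
  rewrite ffunE; apply: eq_bigr => a _.
  under eq_bigr => e _ do rewrite ffunE mulr_sumr mulr_suml.
  rewrite exchange_big; apply: eq_bigr => b _ /=.
  under eq_bigr => e _ do rewrite mulr_sumr mulr_suml.
  rewrite exchange_big; apply: eq_bigr => c _ /=.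
  rewrite (big_morph Posz PoszD (erefl _)) mulr_sumr; apply: eq_bigr => e _.
  by rewrite PoszM; ring.
rewrite ffunE exchange_big /=.
under [RHS]eq_bigr => e _.
  under eq_bigr => c _.
    rewrite ffunE !mulr_suml.
    under eq_bigr => a _ do rewrite !mulr_suml.
    over.
  over.
rewrite [RHS]exchange_big /=.
under [RHS]eq_bigr => c _ do rewrite exchange_big /=.
rewrite [RHS]exchange_big /=.
under [RHS]eq_bigr => a _.
  under eq_bigr => c _ do rewrite exchange_big /=.
  rewrite exchange_big /=.
  over.
rewrite [LHS]exchange_big; apply: eq_bigr => a _; apply: eq_bigr => b _.
apply: eq_bigr => c _; rewrite -(fusionA HN).
rewrite (big_morph Posz PoszD (erefl _)) mulr_sumr; apply: eq_bigr => e _.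
by rewrite PoszM; ring.
Qed.

Lemma basis_one_neq0 : basis one != 0.
Proof. by apply/eqP => /ffunP/(_ one); rewrite !ffunE eqxx. Qed.

HB.instance Definition _ := GRing.Zmodule_isComNzRing.Build R
  fusion_mulA fusion_mulC fusion_mul1 fusion_mulDl basis_one_neq0.

Lemma basisE a b : basis a b = (b == a)%:Z. Proof. by rewrite ffunE. Qed.

Lemma basis1 : basis one = 1. Proof. by []. Qed.

Lemma fusion_oneE a : (1 : R) a = (a == one)%:Z. Proof. exact: basisE. Qed.

Lemma fusion_sumE (K : Type) (r : seq K) (P : pred K) (F : K -> R) a :
  (\sum_(i <- r | P i) F i) a = \sum_(i <- r | P i) F i a.
Proof. exact: sum_ffunE. Qed.

Lemma fusion_subE (x y : R) a : (x - y) a = x a - y a.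
Proof. by rewrite !ffunE. Qed.

Lemma fusion_mulzE (x : R) z a : (x *~ z) a = x a * z.
Proof. by rewrite -[RHS]mulrzz; exact: ffunMzE. Qed.

Lemma fusionE (x : R) : x = \sum_a basis a *~ x a.
Proof.
apply/ffunP=> c; rewrite fusion_sumE (bigD1 c) //= big1 ?addr0 => [|a ac].
  by rewrite fusion_mulzE basisE eqxx mul1r.
by rewrite fusion_mulzE basisE eq_sym (negPf ac) mul0r.
Qed.

Lemma mulE (x y : R) c : (x * y) c = \sum_a \sum_b x a * y b * (N a b c)%:Z.
Proof. by rewrite ffunE. Qed.

Lemma mul_basisE a (y : R) c : (basis a * y) c = \sum_b y b * (N a b c)%:Z.
Proof.
rewrite mulE (bigD1 a) //= [X in _ + X]big1 ?addr0 => [|e /negPf ea].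
  by apply: eq_bigr => b _; rewrite basisE eqxx mul1r.
by apply: big1 => b _; rewrite basisE ea !mul0r.
Qed.

Definition star (x : R) : R := [ffun a => x (dual a)].

Lemma starE x a : star x a = x (dual a). Proof. by rewrite ffunE. Qed.

Lemma star_is_zmod_morphism : zmod_morphism star.
Proof. by move=> x y; apply/ffunP=> a; rewrite !ffunE. Qed.
HB.instance Definition _ := GRing.isZmodMorphism.Build R R star
  star_is_zmod_morphism.

Lemma star_basis a : star (basis a) = basis (dual a).
Proof.
apply/ffunP=> b; rewrite starE !basisE; congr (nat_of_bool _)%:Z.
by rewrite -(inj_eq (inv_inj (dualK HN))) (dualK HN).
Qed.

Lemma star_is_monoid_morphism : monoid_morphism star.
Proof.
split=> [|x y]; first by rewrite -basis1 star_basis (dual_one HN).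
apply/ffunP=> c; rewrite starE !mulE (reindex_inj (inv_inj (dualK HN))) /=.
apply: eq_bigr => a _; rewrite (reindex_inj (inv_inj (dualK HN))) /=.
by apply: eq_bigr => b _; rewrite !starE (fusion_dual HN).
Qed.
HB.instance Definition _ := GRing.isMonoidMorphism.Build R R star
  star_is_monoid_morphism.

Lemma starK : involutive star.
Proof. by move=> x; apply/ffunP=> a; rewrite !starE (dualK HN). Qed.

Definition counit (x : R) : int := x one.

Lemma counit_is_zmod_morphism : zmod_morphism counit.
Proof. by move=> x y; rewrite /counit !ffunE. Qed.
HB.instance Definition _ := GRing.isZmodMorphism.Build R int counit
  counit_is_zmod_morphism.

Lemma counit_star x : counit (star x) = counit x.
Proof. by rewrite /counit starE (dual_one HN). Qed.

Lemma counit_basis_mul a x : counit (basis a * x) = x (dual a).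
Proof.
rewrite /counit mul_basisE (bigD1 (dual a)) //= big1 ?addr0 => [|b].
  by rewrite (fusion_one HN) eqxx mulr1.
by move=> /negPf nb; rewrite (fusion_one HN) nb mulr0.
Qed.

(** The basis is orthonormal for this pairing, which is therefore positive definite; the later
    vanishing arguments rest on this. *)
Lemma counit_mul_star x y : counit (x * star y) = \sum_a x a * y a.
Proof.
rewrite [x in LHS]fusionE mulr_suml raddf_sum; apply: eq_bigr => a _ /=.
by rewrite mulrzAl raddfMz /= counit_basis_mul starE (dualK HN) mulrC mulrzz.
Qed.

Lemma counit_star_ge0 x : 0 <= counit (x * star x).
Proof. by rewrite counit_mul_star sumr_ge0 // => a _; rewrite -expr2 sqr_ge0. Qed.

Lemma counit_star_eq0 x : counit (x * star x) = 0 -> x = 0.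
Proof.
rewrite counit_mul_star => /eqP; rewrite psumr_eq0 => [|a _]; last first.
  by rewrite -expr2 sqr_ge0.
move=> /allP h; apply/ffunP=> a; apply/eqP; rewrite ffunE.
by have := h a (mem_index_enum _); rewrite mulf_eq0 orbb.
Qed.

Lemma counit_nondeg x : (forall y, counit (x * y) = 0) -> x = 0.
Proof. by move=> h; apply: counit_star_eq0; rewrite h. Qed.

Lemma mul_star_eq0 x : x * star x = 0 -> x = 0.
Proof. by move=> h; apply: counit_star_eq0; rewrite h raddf0. Qed.

(** Parseval's identity for the orthonormal basis. It lets a sum over dual pairs join two separate
    factors into one, as in the merging of orbits. *)
Lemma counit_copairing y z :
  \sum_c counit (basis c * y) * counit (basis (dual c) * z) = counit (y * z).
Proof.
rewrite -[z in RHS]starK counit_mul_star (reindex_inj (inv_inj (dualK HN))).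
by apply: eq_bigr => c _; rewrite !counit_basis_mul !(dualK HN) starE.
Qed.

(** * Sums of Hermitian squares and positive elements *)

Definition hermitian_square (x : R) : Prop :=
  exists s : seq R, x = \sum_(z <- s) z * star z.

Lemma hermitian_squareM x y :
  hermitian_square x -> hermitian_square y -> hermitian_square (x * y).
Proof.
move=> [s ->] [t ->]; exists [seq z * w | z <- s, w <- t].
rewrite mulr_suml big_allpairs_dep; apply: eq_bigr => z _.
by rewrite mulr_sumr; apply: eq_bigr => w _; rewrite rmorphM /=; ring.
Qed.

Lemma hermitian_square_ge0 k x :
  hermitian_square k -> 0 <= counit (k * x * star x).
Proof.
move=> [s ->]; rewrite !mulr_suml raddf_sum sumr_ge0 // => z _.
rewrite (_ : _ * _ = (z * x) * star (z * x)) ?counit_star_ge0 //.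
by rewrite rmorphM /=; ring.
Qed.

(** The pairing twisted by [k] is a sum of squared norms of the products [z * x], so each of these
    products vanishes. *)
Lemma hermitian_square_eq0 k x :
  hermitian_square k -> counit (k * x * star x) = 0 -> k * x = 0.
Proof.
move=> [s ->]; rewrite !mulr_suml raddf_sum /= => h.
have E z : counit (z * star z * x * star x) = counit ((z * x) * star (z * x)).
  by congr counit; rewrite rmorphM /=; ring.
move/eqP: h; under eq_bigr do rewrite E.
rewrite psumr_eq0 => [/allP h|z _]; last exact: counit_star_ge0.
apply: big1_seq => z /andP[_ zs]; have /eqP/counit_star_eq0 zx := h _ zs.
by rewrite mulrAC zx mul0r.
Qed.

(** An integral certificate for nonnegativity on the spectrum. The element [k] acts as a
    denominator, itself nonnegative and not a zero divisor; square roots need not exist over the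
    integers. *)
Definition positive (x : R) : Prop :=
  star x = x /\ exists k, [/\ hermitian_square k, hermitian_square (k * x)
                            & forall y, k * y = 0 -> y = 0].

Lemma positive1 : positive 1.
Proof.
have h : hermitian_square 1 by exists [:: 1]; rewrite big_seq1 rmorph1 mulr1.
by split; [exact: rmorph1 | exists 1; split; rewrite ?mulr1 // => y; rewrite mul1r].
Qed.

Lemma positiveM x y : positive x -> positive y -> positive (x * y).
Proof.
move=> [sx [k [hk hkx rk]]] [sy [l [hl hly rl]]].
split; first by rewrite rmorphM /= sx sy.
exists (k * l); split; first exact: hermitian_squareM.
  by rewrite mulrACA; exact: hermitian_squareM.
by move=> z; rewrite -mulrA => /rk/rl.
Qed.

(* In the semisimple algebra over the reals, [x] and [y] are the unique
   nonnegative square roots of their common square. *)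
Lemma positive_sqr_inj x y : positive x -> positive y -> x ^+ 2 = y ^+ 2 -> x = y.
Proof.
move=> [sx [k [hk hkx rk]]] [sy [l [hl hly rl]]] exy.
pose d := x - y; pose X := k * l * x; pose Y := k * l * y.
have hX : hermitian_square X.
  by rewrite /X mulrAC; exact: hermitian_squareM.
have hY : hermitian_square Y.
  by rewrite /Y -mulrA; exact: hermitian_squareM.
(* The factor [k * l] clears both denominators at once, so that factoring [x ^+ 2 - y ^+ 2] yields
   two nonnegative numbers with sum zero. *)
have XY0 : (X + Y) * d = 0.
  rewrite (_ : _ * d = k * l * (x ^+ 2 - y ^+ 2)); last by rewrite /X /Y /d; ring.
  by rewrite exy subrr mulr0.
have h0 : counit (X * d * star d) + counit (Y * d * star d) = 0.
  by rewrite -raddfD /= -!mulrDl XY0 mul0r raddf0.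
have /andP[/eqP X0 /eqP Y0] :
    (counit (X * d * star d) == 0) && (counit (Y * d * star d) == 0).
  by rewrite -paddr_eq0 ?h0 // hermitian_square_ge0.
have {}X0 : x * d = 0.
  by apply/rl/rk; rewrite !mulrA; exact: hermitian_square_eq0.
have {}Y0 : y * d = 0.
  by apply/rl/rk; rewrite !mulrA; exact: hermitian_square_eq0.
(* Since [d] is self-dual, [d * star d] expands to [x * d - y * d]. *)
apply/eqP; rewrite -subr_eq0; apply/eqP/mul_star_eq0.
by rewrite raddfB /= sx sy -/d {1}/d mulrBl X0 Y0 subrr.
Qed.

(** The norm of [x * y] is the coefficient of 1 in [x ^+ 2 * y * star y], and the pairing is
    definite. *)
Lemma positive_sqr_absorb x y : star x = x -> x ^+ 2 * y = 0 -> x * y = 0.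
Proof.
move=> sx h; apply: mul_star_eq0; rewrite rmorphM /= sx.
by transitivity (x ^+ 2 * y * star y); [ring | rewrite h mul0r].
Qed.

End FusionRing.

(** * Tensor powers and multiplication of layers *)

Lemma prod_eqb (J : finType) (I : eqType) (a b : {ffun J -> I}) :
  (\prod_j (a j == b j) = (a == b) :> nat)%N.
Proof.
have [->|ab] := eqVneq a b; first by rewrite big1 // => j _; rewrite eqxx.
have /existsP[j /negPf nj] : [exists j, a j != b j].
  rewrite -negb_forall; apply: contra ab => /forallP h.
  by apply/eqP/ffunP=> j; exact/eqP.
by rewrite (bigD1 j) //= nj mul0n.
Qed.

Lemma PoszM_prod (K : Type) (r : seq K) (P : pred K) (F : K -> nat) :
  (\prod_(k <- r | P k) F k)%N%:Z = \prod_(k <- r | P k) (F k)%:Z.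
Proof. exact: (big_morph Posz PoszM (erefl _)). Qed.

Lemma prodr_mulrz (R : comNzRingType) (K : finType) (F : K -> R) (z : K -> int) :
  \prod_k (F k *~ z k) = (\prod_k F k) *~ (\prod_k z k).
Proof.
by elim/big_rec3: _ => [|k u y x _ ->]; rewrite ?mulr1z // mulrzAl mulrzAr -mulrzA [_ * z k]mulrC.
Qed.

Section TensorRules.
Variables (I : finType) (one : I) (dual : I -> I) (N : I -> I -> I -> nat).
Variables (HN : mtc_fusion_rules one dual N) (J : finType).
Implicit Types a b c d : {ffun J -> I}.

Definition tensor_one : {ffun J -> I} := [ffun _ => one].
Definition tensor_dual a : {ffun J -> I} := [ffun j => dual (a j)].
Definition tensor_fusion a b c := (\prod_j N (a j) (b j) (c j))%N.

(** Each rule holds layer by layer; for associativity the product over layers is exchanged with the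
    sums over labels. Thus tensor powers over layers and over orbits alike inherit everything shown
    for fusion rings. *)
Lemma tensor_rules : mtc_fusion_rules tensor_one tensor_dual tensor_fusion.
Proof.
split=> [a|]; first by apply/ffunP=> j; rewrite !ffunE (dualK HN).
split=> [a c|].
  by rewrite -prod_eqb; apply: eq_bigr => j _; rewrite ffunE (fusion1 HN).
split=> [a b c|].
  by apply: eq_bigr => j _; rewrite (fusionC HN).
split=> [a b c d|].
  under eq_bigr do rewrite -big_split /=.
  under [RHS]eq_bigr do rewrite -big_split /=.
  rewrite -(bigA_distr_bigA (fun j e => N (a j) (b j) e * N e (c j) (d j))%N).
  rewrite -(bigA_distr_bigA (fun j e => N (b j) (c j) e * N (a j) e (d j))%N).
  by apply: eq_bigr => j _; rewrite (fusionA HN).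
split=> [a b|].
  by rewrite -prod_eqb; apply: eq_bigr => j _; rewrite !ffunE (fusion_one HN).
split=> a b c; apply: eq_bigr => j _.
  by rewrite ffunE (fusion_adj HN).
by rewrite !ffunE (fusion_dual HN) (fusionC HN).
Qed.

End TensorRules.

Section Tensor.
Variables (I : finType) (one : I) (dual : I -> I) (N : I -> I -> I -> nat).
Variable HN : mtc_fusion_rules one dual N.
Local Notation C := (fusion_ring HN).
Local Notation Ten J := (fusion_ring (tensor_rules HN J)).

Section Factors.
Variable J : finType.

Definition tens (f : J -> C) : Ten J := [ffun a : {ffun J -> I} => \prod_j f j (a j)].

Lemma tensE f (a : {ffun J -> I}) : tens f a = \prod_j f j (a j).
Proof. by rewrite ffunE. Qed.

Lemma eq_tens f g : f =1 g -> tens f = tens g.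
Proof.
by move=> fg; apply/ffunP=> a; rewrite !ffunE; apply: eq_bigr => j _; rewrite fg.
Qed.

Lemma tensM f g : tens f * tens g = tens (fun j => f j * g j).
Proof.
apply/ffunP=> c; rewrite mulE tensE.
under [RHS]eq_bigr do rewrite mulE.
rewrite bigA_distr_bigA; apply: eq_bigr => a _.
rewrite bigA_distr_bigA; apply: eq_bigr => b _.
by rewrite !big_split /= !tensE PoszM_prod.
Qed.

Lemma tens_basis (a : {ffun J -> I}) : tens (fun j => basis HN (a j)) = basis _ a.
Proof.
apply/ffunP=> b; rewrite tensE basisE -prod_eqb PoszM_prod.
by apply: eq_bigr => j _; rewrite basisE.
Qed.

Lemma tens1 : tens (fun=> 1) = 1.
Proof. by rewrite -[RHS]basis1 -tens_basis; apply: eq_tens => j; rewrite ffunE basis1. Qed.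

Lemma tens_prod (K : Type) (r : seq K) (P : pred K) (f : K -> J -> C) :
  \prod_(k <- r | P k) tens (f k) = tens (fun j => \prod_(k <- r | P k) f k j).
Proof.
elim: r => [|k r IH]; first by rewrite big_nil -tens1; apply: eq_tens => j; rewrite big_nil.
rewrite big_cons; case: ifP => Pk; rewrite IH ?tensM;
  by apply: eq_tens => j; rewrite big_cons Pk.
Qed.

Lemma counit_tens f : counit (tens f) = \prod_j counit (f j).
Proof. by rewrite /counit tensE; apply: eq_bigr => j _; rewrite ffunE. Qed.

Lemma star_tens f : star (tens f) = tens (fun j => star (f j)).
Proof.
apply/ffunP=> a; rewrite starE !tensE.
by apply: eq_bigr => j _; rewrite starE ffunE.
Qed.

Definition layer (j : J) (x : C) : Ten J := tens (fun k => if k == j then x else 1).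

Lemma layerE j x (a : {ffun J -> I}) :
  layer j x a = x (a j) * \prod_(k | k != j) (1 : C) (a k).
Proof.
rewrite tensE (bigD1 j) //= eqxx; congr (_ * _).
by apply: eq_bigr => k /negPf ->.
Qed.

Lemma layer_is_zmod_morphism j : zmod_morphism (layer j).
Proof. by move=> x y; apply/ffunP=> a; rewrite fusion_subE !layerE fusion_subE mulrBl. Qed.
HB.instance Definition _ j := GRing.isZmodMorphism.Build C (Ten J) (layer j)
  (layer_is_zmod_morphism j).

Lemma layer_is_monoid_morphism j : monoid_morphism (layer j).
Proof.
split=> [|x y]; first by rewrite -tens1; apply: eq_tens => k; rewrite if_same.
by rewrite tensM; apply: eq_tens => k; case: eqP; rewrite ?mulr1.
Qed.
HB.instance Definition _ j := GRing.isMonoidMorphism.Build C (Ten J) (layer j)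
  (layer_is_monoid_morphism j).

Lemma star_layer j x : star (layer j x) = layer j (star x).
Proof. by rewrite star_tens; apply: eq_tens => k; case: eqP; rewrite ?rmorph1. Qed.

Lemma prod_layer (K : finType) (g : K -> J) (f : K -> C) :
  \prod_k layer (g k) (f k) = tens (fun j => \prod_(k | g k == j) f k).
Proof.
rewrite tens_prod; apply: eq_tens => j; rewrite [RHS]big_mkcond.
by apply: eq_bigr => k _; rewrite eq_sym.
Qed.

End Factors.

(** * Algebra maps induced by maps of indices, and their adjoints *)

Section Push.
Variables (K J : finType) (g : K -> J).

(** This multiplies the layers in each fibre of [g] and puts the unit at every index outside the
    image. *)
Definition push (x : Ten K) : Ten J :=
  \sum_(a : {ffun K -> I}) (\prod_k layer (g k) (basis HN (a k))) *~ x a.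

Lemma push_is_zmod_morphism : zmod_morphism push.
Proof.
move=> x y; rewrite /push -sumrB; apply: eq_bigr => a _.
by rewrite fusion_subE mulrzBr.
Qed.
HB.instance Definition _ := GRing.isZmodMorphism.Build (Ten K) (Ten J) push
  push_is_zmod_morphism.

Lemma push_tens f : push (tens f) = \prod_k layer (g k) (f k).
Proof.
under [RHS]eq_bigr => k _.
  rewrite (fusionE (f k)) raddf_sum /=.
  under eq_bigr do rewrite raddfMz.
  over.
rewrite bigA_distr_bigA; apply: eq_bigr => a _.
by rewrite prodr_mulrz tensE.
Qed.

Lemma push_is_monoid_morphism : monoid_morphism push.
Proof.
split=> [|x y].
  by rewrite -tens1 push_tens big1 // => k _; rewrite rmorph1.
rewrite (fusionE x) (fusionE y) mulr_suml !raddf_sum mulr_suml.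
apply: eq_bigr => a _; rewrite !mulr_sumr raddf_sum; apply: eq_bigr => b _ /=.
rewrite !(mulrzAl, mulrzAr, raddfMz) /= -!tens_basis tensM !push_tens -big_split.
by do 2 congr (_ *~ _); apply: eq_bigr => k _; rewrite rmorphM.
Qed.
HB.instance Definition _ := GRing.isMonoidMorphism.Build (Ten K) (Ten J) push
  push_is_monoid_morphism.

Lemma push_star x : push (star x) = star (push x).
Proof.
rewrite /push raddf_sum (reindex_inj (inv_inj (dualK (tensor_rules HN K)))).
apply: eq_bigr => a _ /=; rewrite raddfMz /= starE (dualK (tensor_rules HN K)).
congr (_ *~ _); rewrite rmorph_prod; apply: eq_bigr => k _ /=.
by rewrite ffunE -star_basis star_layer.
Qed.

(* The image of 1 under the adjoint of [push], for the pairing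
   [counit (x * star y)]. *)
Definition copush : Ten K :=
  [ffun a : {ffun K -> I} => counit (push (star (basis _ a)))].

Lemma counit_copush x : counit (copush * x) = counit (push x).
Proof.
rewrite mulrC [x in LHS]fusionE mulr_suml /push !raddf_sum.
apply: eq_bigr => a _ /=.
rewrite mulrzAl !raddfMz /= counit_basis_mul ffunE star_basis.
by rewrite (dualK (tensor_rules HN K)) -tens_basis push_tens.
Qed.

(** The adjunction turns pairings with [copush * x] into pairings with [push x]. Nondegeneracy gives
    one implication; definiteness, tested on [star x], gives the other. *)
Lemma copush_eq0 x : copush * x = 0 <-> push x = 0.
Proof.
split=> h; last first.
  by apply: counit_nondeg => y; rewrite -mulrA counit_copush rmorphM /= h mul0r raddf0.
apply: counit_star_eq0; rewrite -push_star -rmorphM -counit_copush /= mulrA.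
by rewrite h mul0r raddf0.
Qed.

Lemma copush_eq x y : copush * x = copush * y <-> push x = push y.
Proof.
have := copush_eq0 (x - y); rewrite mulrBr raddfB /= => -[h1 h2].
by split=> h; apply/subr0_eq; [apply: h1 | apply: h2]; rewrite h subrr.
Qed.

Lemma star_copush : star copush = copush.
Proof.
apply/ffunP=> a; rewrite starE !ffunE -star_basis push_star.
by rewrite counit_star.
Qed.

End Push.

End Tensor.

(** * Gluing layers along copairings *)

Section TensorMaps.
Variables (I : finType) (one : I) (dual : I -> I) (N : I -> I -> I -> nat).
Variable HN : mtc_fusion_rules one dual N.
Local Notation C := (fusion_ring HN).
Local Notation Ten J := (fusion_ring (tensor_rules HN J)).
Local Notation e := (basis HN).

Lemma push_layer (K J : finType) (g : K -> J) i (x : C) :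
  push g (layer i x) = layer (g i) x.
Proof.
rewrite push_tens (bigD1 i) //= eqxx big1 ?mulr1 // => k /negPf ->.
exact: rmorph1.
Qed.

Lemma push_basis (K J : finType) (g : K -> J) (a : {ffun K -> I}) :
  push g (basis (tensor_rules HN K) a) = tens (fun j => \prod_(k | g k == j) e (a k)).
Proof. by rewrite -tens_basis push_tens prod_layer. Qed.

Lemma pushE (K J : finType) (g : K -> J) (x : Ten K) (c : {ffun J -> I}) :
  push g x c =
    \sum_a x a * \prod_j (\prod_(k | g k == j) e (a k)) (c j).
Proof.
rewrite fusion_sumE; apply: eq_bigr => a _.
by rewrite prod_layer fusion_mulzE tensE mulrC.
Qed.

Lemma push_comp (K J L : finType) (g : J -> L) (h : K -> J) (x : Ten K) :
  push g (push h x) = push (g \o h) x.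
Proof.
rewrite [push h x]/push raddf_sum; apply: eq_bigr => a _ /=.
rewrite raddfMz /= rmorph_prod; congr (_ *~ _); apply: eq_bigr => k _ /=.
exact: push_layer.
Qed.

Lemma eq_push (K J : finType) (g h : K -> J) : g =1 h -> @push _ _ _ _ HN _ _ g =1 push h.
Proof.
by move=> gh x; apply: eq_bigr => a _; congr (_ *~ _); apply: eq_bigr => k _; rewrite gh.
Qed.

Lemma push_bijE (J : finType) (g : J -> J) (x : Ten J) (c : {ffun J -> I}) :
  injective g -> push g x c = x [ffun k => c (g k)].
Proof.
move=> gI; rewrite pushE [x in RHS]fusionE fusion_sumE; apply: eq_bigr => a _.
rewrite fusion_mulzE mulrC; congr (_ * _).
rewrite (reindex_inj gI) /= -tens_basis tensE; apply: eq_bigr => k _.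
by rewrite (eq_bigl (pred1 k)) ?big_pred1_eq ?ffunE // => l; rewrite (inj_eq gI).
Qed.

Lemma push_id (J : finType) (x : Ten J) : push id x = x.
Proof.
apply/ffunP=> c; rewrite push_bijE //; congr (x _).
by apply/ffunP=> k; rewrite ffunE.
Qed.

Lemma counit_push_bij (J : finType) (g : J -> J) (x : Ten J) :
  injective g -> counit (push g x) = counit x.
Proof.
move=> gI; rewrite /counit push_bijE //; congr (x _).
by apply/ffunP=> k; rewrite !ffunE.
Qed.

Lemma counit_push_basis (K J : finType) (g : K -> J) (a : {ffun K -> I}) :
  counit (push g (basis (tensor_rules HN K) a)) =
    \prod_j counit (\prod_(k | g k == j) e (a k)).
Proof. by rewrite push_basis counit_tens. Qed.

Lemma eq_basis_counit (K : finType) (x y : Ten K) :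
  (forall a, counit (x * basis _ a) = counit (y * basis _ a)) -> x = y.
Proof.
move=> h; apply/ffunP=> a; rewrite -[a](dualK (tensor_rules HN K)).
by rewrite -!counit_basis_mul ![basis _ _ * _]mulrC h.
Qed.

(** No two layers are multiplied and indices outside the image contribute the factor 1, so [push]
    preserves the coefficient of 1. *)
Lemma copush_inj (K J : finType) (g : K -> J) : injective g -> copush HN g = 1.
Proof.
move=> gI; apply: eq_basis_counit => a.
rewrite mul1r counit_copush counit_push_basis -tens_basis counit_tens.
transitivity (\prod_(j in g @: K) counit (\prod_(k | g k == j) e (a k))).
  rewrite [RHS]big_mkcond; apply: eq_bigr => j _; case: ifP => // /negP nj.
  rewrite big_pred0 => [|k]; first by rewrite -basis1 /counit basisE eqxx.
  by apply/eqP=> gk; apply: nj; rewrite -gk imset_f.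
rewrite big_imset => [|k l _ _ /gI] //=; apply: eq_bigr => k _.
by rewrite (eq_bigl (pred1 k)) ?big_pred1_eq // => l; rewrite (inj_eq gI).
Qed.

(** * Copairings and the merging of two layers *)

Section Copairing.
Variable K : finType.

Definition copairing (i j : K) : Ten K := \sum_c layer i (e c) * layer j (e (dual c)).

(** By [counit_copairing], the coefficient of 1 in the product over the joined fibre splits over the
    two old fibres, which produces the factor [copairing i j]. The joined fibre sits at a fresh
    index [u], because orbits will be their own indices and a union of two orbits is a new one. *)
Lemma copush_merge (J : finType) (g g' : K -> J) (i j : K) (u : J) :
    g i != g j -> (forall k, g k != u) ->
    (forall k, g' k = if (g k == g i) || (g k == g j) then u else g k) ->
  copush HN g' = copairing i j * copush HN g.
Proof.
move=> gij gu g'E; apply: eq_basis_counit => a.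
rewrite mulrAC [_ * copush _ _]mulrC !counit_copush counit_push_basis.
rewrite rmorphM /= push_basis raddf_sum mulr_suml raddf_sum /=.
pose P l := \prod_(k | g k == l) e (a k).
pose P' l := \prod_(k | g' k == l) e (a k).
pose rest := \prod_(l | (l != g i) && (l != g j)) counit (P l).
transitivity (counit (P (g i) * P (g j)) * rest); last first.
  rewrite -counit_copairing mulr_suml; apply: eq_bigr => c _.
  rewrite rmorphM /= !push_layer !tensM counit_tens.
  rewrite (bigD1 (g i)) //= (bigD1 (g j)) 1?eq_sym //= !eqxx.
  rewrite [g j == g i]eq_sym (negPf gij) !(mulr1, mul1r) mulrA; congr (_ * _).
  by apply: eq_bigr => l /andP[/negPf -> /negPf ->]; rewrite !mul1r.
have counit1 : counit (1 : C) = 1 by rewrite -basis1 /counit basisE eqxx.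
rewrite (bigD1 u) //= -/(P' u); congr (counit _ * _).
  rewrite /P' (eq_bigl (fun k => (g k == g i) || (g k == g j))) => [|k]; last first.
    by rewrite g'E; case: ifP => _; rewrite ?eqxx // (negPf (gu k)).
  rewrite (bigID (fun k => g k == g i)) /=; congr (_ * _); apply: eq_bigl => k.
    by case: eqP => //=; rewrite andbF.
  by case: eqP => [->|]; rewrite ?andbF ?andbT // (negPf gij).
rewrite big_mkcond [rest]big_mkcond; apply: eq_bigr => l _ /=.
have [->|lu] /= := eqVneq l u.
  rewrite /P big_pred0 ?counit1 ?if_same // => k; exact: negbTE (gu k).
rewrite -negb_or; case: ifPn => [|/negPn hl].
  rewrite negb_or => /andP[li lj]; congr counit; apply: eq_bigl => k.
  rewrite g'E; case: ifP => // /orP[] /eqP ->.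
    by rewrite eq_sym (negPf lu) eq_sym (negPf li).
  by rewrite eq_sym (negPf lu) eq_sym (negPf lj).
(* The indices [g i] and [g j] are no longer values of [g'], so their factors are empty products. *)
rewrite big_pred0 // => k; rewrite g'E; case: ifP => [_|/negP hk].
  by rewrite eq_sym (negPf lu).
by apply/eqP=> kl; apply: hk; rewrite kl.
Qed.

Section Positive.
Variables i j : K.
Hypothesis ij : i != j.

(** Identifies exactly [i] and [j]. Sets are taken as values because [[set i; j]] is not a singleton
    and so is fresh for [copush_merge]. *)
Let g (k : K) : {set K} := if (k == i) || (k == j) then [set i; j] else [set k].

Lemma copairing_copush : copairing i j = copush HN g.
Proof.
have sI : injective (@set1 K) by exact: set1_inj.
rewrite (@copush_merge _ (@set1 K) g i j [set i; j]) ?(inj_eq sI) //.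
- by rewrite (copush_inj sI) mulr1.
- move=> k; apply/eqP=> /setP h.
  have := h i; have := h j; rewrite !inE !eqxx orbT => /eqP jk /eqP ik.
  by move: ij; rewrite ik jk eqxx.
- by move=> k; rewrite /g !(inj_eq sI).
Qed.

Lemma star_copairing : star (copairing i j) = copairing i j.
Proof. by rewrite copairing_copush star_copush. Qed.

(** The two layers have the same image once [i] and [j] are multiplied together, so an element
    slides across the copairing. *)
Lemma copairing_layer x : copairing i j * layer i x = copairing i j * layer j x.
Proof.
rewrite copairing_copush; apply/copush_eq.
by rewrite !push_layer /g !eqxx orbT.
Qed.

(** The denominator is the sum of all [c * c^*] placed in layer [i]: sliding layers shows that it
    multiplies the copairing to its own square. *)
Lemma positive_copairing : positive (copairing i j).
Proof.
split; first exact: star_copairing.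
pose z c : Ten K := layer i (e c).
pose s := [seq z c | c <- enum I].
have sE : \sum_(w <- s) w * star w = \sum_c z c * layer i (e (dual c)).
  by rewrite big_map big_enum; apply: eq_bigr => c _; rewrite star_layer star_basis.
exists (\sum_(w <- s) w * star w); split; first by exists s.
- exists [:: copairing i j]; rewrite big_seq1 star_copairing mulrC {3}/copairing.
  rewrite sE !mulr_sumr; apply: eq_bigr => c _.
  by rewrite ![z c * _]mulrC !mulrA copairing_layer.
(* The denominator is not a zero divisor because its summand at [c = one] is 1. *)
- move=> y h; have : counit (\sum_(w <- s) w * star w * y * star y) = 0.
    by rewrite -!mulr_suml h mul0r raddf0.
  rewrite big_map big_enum raddf_sum /= => /eqP.
  under eq_bigr => c _.
    rewrite (_ : _ * star y = (z c * y) * star (z c * y)); last first.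
      by rewrite rmorphM /=; ring.
    over.
  rewrite psumr_eq0 => [/allP/(_ one (mem_index_enum _))/eqP|c _].
    by move/counit_star_eq0; rewrite /z basis1 rmorph1 mul1r.
  exact: counit_star_ge0.
Qed.

End Positive.
End Copairing.
End TensorMaps.

(** * Orbits and transposition lists *)

Section PermOrbits.
Variable T : finType.
Implicit Types (s : {perm T}) (i j k : T).

(** Multiplying by a transposition changes the number of orbits by one, up or down according to
    whether [i] and [j] share an orbit. Doing it twice restores the number. Inverses appear because
    [porbits_mul_tperm] multiplies on the left. *)
Lemma porbit_tperm_sep s i j :
  i != j -> (i \in porbit (s * tperm i j)%g j) = (i \notin porbit s j).
Proof.
move=> ij; pose t := tperm i j.
have E : ((s * t)^-1 = t * s^-1)%g by rewrite invMg tpermV.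
have := porbits_mul_tperm s^-1 i j; have := porbits_mul_tperm (s * t)^-1 i j.
have E2 : (t * (s * t)^-1 = s^-1)%g by rewrite E mulgA tperm2 mul1g.
rewrite /= -/t E2 -E !porbitsV !porbitV ij.
by do 2 case: (i \in _) => //=; lia.
Qed.

(** The union of the two orbits is stable under the new permutation [s'], and the [s']-orbit of [i],
    which contains [j], is stable under [s]. *)
Lemma porbit_mul_tperm s i j k : i \notin porbit s j ->
  porbit (s * tperm i j)%g k =
    if (porbit s k == porbit s i) || (porbit s k == porbit s j)
    then porbit s i :|: porbit s j else porbit s k.
Proof.
move=> sij; pose t := tperm i j; pose s' := (s * t)%g.
have ij : i != j by apply: contraNneq sij => ->; exact: porbit_id.
have s'ij : porbit s' i = porbit s' j.
  by apply/eqP; rewrite eq_porbit_mem porbit_tperm_sep.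
have fwd l (A : {set T}) (u : {perm T}) :
    (forall x, x \in A -> u x \in A) -> l \in A -> porbit u l \subset A.
  move=> cA lA; apply/subsetP => _ /porbitP[m ->].
  by elim: m => [|m IH]; rewrite ?perm1 // expgSr permM cA.
have step (u : {perm T}) l x : x \in porbit u l -> u x \in porbit u l.
  rewrite -!eq_porbit_mem => /eqP <-; rewrite eq_porbit_mem.
    by have := mem_porbit u 1 x; rewrite expg1.
case: ifPn => [kij|].
  have closed_t (A : {set T}) x : i \in A -> j \in A -> x \in A -> t x \in A.
    by move=> iA jA xA; rewrite /t; case: tpermP.
  have iS : i \in porbit s' i by exact: porbit_id.
  have jS : j \in porbit s' i by rewrite s'ij porbit_id.
  have closed_s x : x \in porbit s' i -> s x \in porbit s' i.
    move=> xS; rewrite (_ : s x = t (s' x)); last by rewrite permM tpermK.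
    by apply: closed_t => //; exact: step.
  have sub1 : porbit s i :|: porbit s j \subset porbit s' i.
    by rewrite subUset !fwd.
  have <- : porbit s' i = porbit s i :|: porbit s j.
    apply/eqP; rewrite eqEsubset sub1 andbT; apply: fwd => [x|]; last first.
      by rewrite inE porbit_id.
    move=> xU; rewrite permM; apply: closed_t; rewrite ?inE ?porbit_id ?orbT //.
    by move: xU; rewrite !inE => /orP[] /step ->; rewrite ?orbT.
  apply/eqP; rewrite eq_porbit_mem; apply: (subsetP sub1); rewrite inE.
  by rewrite -!eq_porbit_mem.
rewrite negb_or => /andP[ki kj].
(* Away from the orbits of [i] and [j] the transposition never acts. *)
have pw m : (s' ^+ m)%g k = (s ^+ m)%g k.
  elim: m => [|m IH]; first by rewrite !expg0.
  have sE : s ((s ^+ m)%g k) = (s ^+ m.+1)%g k by rewrite expgSr permM.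
  rewrite expgSr permM IH {1}/s' permM sE tpermD //.
    by apply: contraNneq ki => ->; rewrite eq_porbit_mem porbit_sym mem_porbit.
  by apply: contraNneq kj => ->; rewrite eq_porbit_mem porbit_sym mem_porbit.
by apply/setP=> x; apply/porbitP/porbitP => -[m ->]; exists m; rewrite pw.
Qed.

Lemma porbitJ s r k : porbit (s ^ r)%g (r k) = r @: porbit s k.
Proof.
apply/setP=> x; apply/porbitP/imsetP => [[m ->]|[_ /porbitP[m ->] ->]].
  by exists ((s ^+ m)%g k); rewrite ?mem_porbit // -conjXg permJ.
by exists m; rewrite -conjXg permJ.
Qed.

End PermOrbits.

(** * Words of transpositions for permutations *)

Section TranspositionLists.
Variable n : nat.
Implicit Types (r s : {perm 'I_n}) (k : 'I_n).

Definition lmul (l : seq ('I_n * 'I_n)) s : {perm 'I_n} :=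
  foldr (fun t p => pcomp (tperm t.1 t.2) p) s l.

(* Every step merges a singleton orbit into another one, so that [F = 1]. *)
Fixpoint merging (l : seq ('I_n * 'I_n)) s : bool :=
  if l is t :: l' then
    [&& merging l' s, lmul l' s t.1 == t.1 & t.1 != t.2] else true.

Lemma lmul_cat l1 l2 s : lmul (l1 ++ l2) s = lmul l1 (lmul l2 s).
Proof. exact: foldr_cat. Qed.

Lemma merging_cat l1 l2 s :
  merging (l1 ++ l2) s = merging l1 (lmul l2 s) && merging l2 s.
Proof.
elim: l1 => //= t l1 ->; rewrite lmul_cat -!andbA.
by case: (merging l2 s); rewrite ?andbT ?andbF.
Qed.

Lemma lmulE l s : lmul l s = (s * lmul l 1)%g.
Proof. by elim: l => [|t l IH] /=; rewrite ?mulg1 // /pcomp IH mulgA. Qed.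

Definition path_pairs r k j m : seq ('I_n * 'I_n) :=
  [seq ((r ^+ i)%g k, (r ^+ i.+1)%g k) | i <- iota j m].

(** The word acts from its right end: the cycle on the later points is built first, and the leftmost
    transposition inserts the still fixed point of exponent [j]. There are [m] transpositions on
    [m + 1] points, hence the inclusive bounds. *)
Lemma path_pairsP r k m j s :
    (forall i i', (j <= i <= j + m)%N -> (j <= i' <= j + m)%N ->
      (r ^+ i)%g k = (r ^+ i')%g k -> i = i') ->
    (forall i, (j <= i <= j + m)%N -> s ((r ^+ i)%g k) = (r ^+ i)%g k) ->
  let p := lmul (path_pairs r k j m) s in
  [/\ merging (path_pairs r k j m) s,
      forall i, (j <= i < j + m)%N -> p ((r ^+ i)%g k) = (r ^+ i.+1)%g k,
      p ((r ^+ (j + m))%g k) = (r ^+ j)%g k &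
      forall x, (forall i, (j <= i <= j + m)%N -> x != (r ^+ i)%g k) -> p x = s x].
Proof.
elim: m j => [|m IH] j inj fix_s /=.
  split=> //; last by rewrite addn0 fix_s // leqnn addn0 leqnn.
  by move=> i; rewrite addn0; lia.
have [| |mg pE pl po] := IH j.+1.
- by move=> i i' h h'; apply: inj; lia.
- by move=> i h; apply: fix_s; lia.
pose x i := (r ^+ i)%g k.
have xinj i i' : (j <= i <= j + m.+1)%N -> (j <= i' <= j + m.+1)%N ->
    x i = x i' -> i = i' by exact: inj.
have pj : lmul (path_pairs r k j.+1 m) s (x j) = x j.
  rewrite po; first by apply: fix_s; lia.
  by move=> i h; apply/eqP => /xinj; lia.
split.
- rewrite mg pj eqxx /=; apply/eqP => /xinj; lia.
- move=> i h; rewrite permM; have [->|ij] := eqVneq i j.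
    by rewrite pj tpermL.
  rewrite pE; last by lia.
  by rewrite tpermD //; apply/eqP => /xinj; lia.
- by rewrite permM addnS -addSn pl tpermR.
- move=> y hy; rewrite permM po; last by move=> i h; apply: hy; lia.
  have sy i : (j <= i <= j + m.+1)%N -> s y != x i.
    move=> h; apply: contra (hy i h) => /eqP E.
    by apply/eqP; apply: (@perm_inj _ s); rewrite E fix_s.
  by rewrite tpermD // eq_sym sy //; lia.
Qed.

Definition cycle_pairs r k := path_pairs r k 0 #|porbit r k|.-1.

Lemma cycle_pairsP r k s :
    {in porbit r k, forall x, s x = x} ->
  let p := lmul (cycle_pairs r k) s in
  merging (cycle_pairs r k) s /\
  forall x, p x = if x \in porbit r k then r x else s x.
Proof.
move=> fix_s; set L := #|porbit r k|.
have L0 : (0 < L)%N by rewrite lt0n card_porbit_neq0.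
have inj i i' : (0 <= i <= 0 + L.-1)%N -> (0 <= i' <= 0 + L.-1)%N ->
    (r ^+ i)%g k = (r ^+ i')%g k -> i = i'.
  have /(nth_uniq k) U := uniq_traject_porbit r k.
  move=> hi hi' E; apply/eqP; rewrite -U ?size_traject -/L; try lia.
  by rewrite !nth_traject -/L; try lia; rewrite -!permX E.
have [|mg pE pl po] := path_pairsP inj (s := s).
  by move=> i _; apply: fix_s; exact: mem_porbit.
split=> // x; case: ifPn => [|xk]; last first.
  by apply: po => i _; apply: contraNneq xk => ->; exact: mem_porbit.
rewrite porbit_traject => /trajectP[i iL ->]; rewrite -permX.
(* The last of the [L] points returns to the start, as [r ^+ L] fixes [k]; the others move one step
   along the path. *)
have [iE|iE] := eqVneq i L.-1.
  have rx : r ((r ^+ L.-1)%g k) = k.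
    by rewrite -permM -expgSr prednK // permX iter_porbit.
  by rewrite iE rx; have := pl; rewrite add0n expg0 perm1.
by rewrite pE ?expgSr ?permM // add0n; lia.
Qed.

Lemma tlistE r : tlist r = flatten [seq cycle_pairs r k | k <- enum 'I_n & cycle_min r k].
Proof. by []. Qed.

(** Cycles are added one at a time; since they are disjoint, the points of a new cycle are still
    fixed by the product so far. *)
Lemma tlistP r : lmul (tlist r) 1 = r /\ merging (tlist r) 1.
Proof.
have main ks : uniq ks -> all (cycle_min r) ks ->
    let l := flatten [seq cycle_pairs r k | k <- ks] in
    merging l 1 /\ forall x, lmul l 1 x = if has (fun k => x \in porbit r k) ks then r x else x.
  elim: ks => [|k ks IH] /=; first by split=> // x; rewrite perm1.
  move=> /andP[kks uks] /andP[mk mks]; have [mg pE] := IH uks mks.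
  have [|mg' pE'] := @cycle_pairsP r k (lmul (flatten [seq cycle_pairs r k0 | k0 <- ks]) 1).
    move=> x xk; rewrite pE; case: hasP => // -[k' k'ks xk'].
    (* Two least elements of one orbit coincide, so no cycle is listed twice. *)
    have kk' : porbit r k = porbit r k'.
      by move: xk xk'; rewrite -!eq_porbit_mem => /eqP <- /eqP.
    case/negP: kks; suff -> : k = k' by [].
    apply/val_inj/eqP; rewrite eqn_leq.
    have /forall_inP mk' := allP mks _ k'ks; move/forall_inP: mk => mk.
    by rewrite mk ?mk' ?kk' ?porbit_id // -kk' porbit_id.
  split; first by rewrite merging_cat mg' mg.
  by move=> x; rewrite lmul_cat pE' pE; case: (x \in _).
have [||mg pE] := main [seq k <- enum 'I_n | cycle_min r k].
- by rewrite filter_uniq ?enum_uniq.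
- by apply/allP => k; rewrite mem_filter => /andP[].
split; last by rewrite tlistE.
apply/permP => x; rewrite tlistE pE; case: hasP => // -[].
have [k kx kmin] := @arg_minnP _ x [in porbit r x] val (porbit_id r x).
exists k; last by rewrite porbit_sym; exact: kx.
rewrite mem_filter mem_enum andbT; apply/forall_inP => j.
have /eqP-> : porbit r k == porbit r x by rewrite eq_porbit_mem.
exact: kmin.
Qed.

Lemma tlist_neq r t : t \in tlist r -> t.1 != t.2.
Proof.
have [_] := tlistP r; elim: (tlist r) => //= u l IH /and3P[ml _ uu].
by rewrite inE => /predU1P[->|/IH ->].
Qed.

End TranspositionLists.

(** * Sectors and structure elements *)

Lemma mul_absorb (R : comNzRingType) (a b c x y : R) :
  a * x = a * y -> a * b * c * (x - y) = 0.
Proof.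
by move=> h; transitivity (b * c * (a * x - a * y)); [ring | rewrite h subrr mulr0].
Qed.

Lemma mul_absorbr (R : comNzRingType) (a b c x y : R) :
  b * x = b * y -> a * b * c * (x - y) = 0.
Proof. by rewrite [a * b]mulrC; exact: mul_absorb. Qed.

(** The squared form of associativity: [f] and [g] stand for the [F] factors, the other letters for
    sector elements. *)
Lemma mul_sqr_assoc (R : comNzRingType) (a b c ab bc f g p : R) :
  ab * f ^+ 2 = a * b -> bc * g ^+ 2 = b * c ->
  ab * c * p * f ^+ 2 = a * bc * p * g ^+ 2.
Proof.
move=> hab hbc; transitivity (ab * f ^+ 2 * (c * p)); first by ring.
by rewrite hab; transitivity (a * p * (bc * g ^+ 2)); [rewrite hbc; ring | ring].
Qed.

Section DefectSectors.
Variables (I : finType) (one : I) (dual : I -> I) (N : I -> I -> I -> nat).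
Variable HN : mtc_fusion_rules one dual N.
Variable n : nat.
Local Notation C := (fusion_ring HN).
Local Notation Ten J := (fusion_ring (tensor_rules HN J)).
Local Notation T := {ffun 'I_n -> I}.
Local Notation A := (Ten 'I_n).
Local Notation e := (basis HN).
Local Notation omega_ := (copairing HN).
Implicit Types (r s : {perm 'I_n}) (x y : A) (a b c : T).

Lemma mulAE x y : mulA N x y = x * y. Proof. by []. Qed.

Lemma deltaA1 : deltaA (vec1 one n) = 1 :> A. Proof. by []. Qed.

Lemma omegaE (i j : 'I_n) : i != j -> omega one dual i j = omega_ i j.
Proof.
move=> ij; rewrite /copairing.
transitivity (\sum_c basis (tensor_rules HN 'I_n)
    [ffun k => if k == i then c else if k == j then dual c else one]).
  by apply/ffunP=> a; rewrite ffunE fusion_sumE; apply: eq_bigr => c _; rewrite basisE.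
apply: eq_bigr => c _; rewrite tensM -tens_basis; apply: eq_tens => k.
rewrite ffunE; case: eqP => [->|_]; first by rewrite (negPf ij) mulr1.
by rewrite mul1r; case: eqP.
Qed.

(** The target is indexed by all subsets, so that it does not depend on [s]; subsets that are not
    orbits carry the unit. *)
Definition psi s : A -> Ten {set 'I_n} := push (porbit s).
Definition sectorE s : A := copush HN (porbit s).
Local Notation E := sectorE.

Lemma sectorE1 : E 1 = 1.
Proof.
apply: copush_inj => i j /eqP; rewrite eq_porbit_mem => /porbitP[m ->].
by rewrite expg1n perm1.
Qed.

Lemma sectorE_merge s (i j : 'I_n) : i \notin porbit s j ->
  E (pcomp (tperm i j) s) = omega_ i j * E s.
Proof.
move=> sij; have gij : porbit s i != porbit s j by rewrite eq_porbit_mem.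
rewrite /sectorE; apply: (copush_merge _ gij (u := porbit s i :|: porbit s j)) => k; last first.
  exact: porbit_mul_tperm.
(* An orbit equal to the union would contain both [i] and [j], so the union is a fresh index. *)
apply: contraNneq gij => kE.
have /eqP -> : porbit s i == porbit s k.
  by rewrite eq_porbit_mem kE inE porbit_id.
by rewrite eq_sym eq_porbit_mem kE inE porbit_id orbT.
Qed.

Lemma sectorE_split s (i j : 'I_n) : i != j -> i \in porbit s j ->
  E s = omega_ i j * E (pcomp (tperm i j) s).
Proof.
move=> ij sij; rewrite -sectorE_merge; last by rewrite porbit_tperm_sep // sij.
by rewrite /pcomp -mulgA tperm2 mulg1.
Qed.

(** The invariant of the algorithm: a merging step adds one copairing to [E], while a splitting step
    removes one from [E] and adds two to the square of the accumulator. Either way the left side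
    gains exactly one. *)
Lemma fold_Fstep (l : seq ('I_n * 'I_n)) s :
  all (fun t => t.1 != t.2) l ->
  let xp := foldr (@Fstep _ one dual N n) (deltaA (vec1 one n), s) l in
  [/\ xp.2 = lmul l s, positive (xp.1 : A) &
      E xp.2 * (xp.1 : A) ^+ 2 = (\prod_(t <- l) omega_ t.1 t.2) * E s].
Proof.
elim: l => [_|[i j] l IH /= /andP[ij lneq]] /=.
  by split=> //; [exact: positive1 | rewrite big_nil deltaA1 expr1n mulr1 mul1r].
have {IH} := IH lneq; case: (foldr _ _ l) => x p /= [-> px xE].
rewrite big_cons -mulrA -xE /=; case: ifP => jp.
  have ip : i \in porbit (lmul l s) j by rewrite porbit_sym.
  split=> //; rewrite omegaE //.
    by apply: positiveM => //; exact: positive_copairing.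
  by rewrite [E (lmul _ _) in RHS](sectorE_split ij ip) mulAE; ring.
have ip : i \notin porbit (lmul l s) j by rewrite porbit_sym jp.
by split=> //; rewrite sectorE_merge //= -mulrA.
Qed.

Lemma fold_Fstep_merging (l : seq ('I_n * 'I_n)) s : merging l s ->
  (foldr (@Fstep _ one dual N n) (deltaA (vec1 one n), s) l).1 = deltaA (vec1 one n)
  /\ (foldr (@Fstep _ one dual N n) (deltaA (vec1 one n), s) l).2 = lmul l s.
Proof.
elim: l => //= -[i j] l IH /= /and3P[/IH] {IH}; case: (foldr _ _ l) => x p /= [-> ->].
move=> /eqP fix_i ij; split=> //; case: ifP => // /porbitP[m jE].
case/eqP: ij; rewrite jE; elim: m {jE} => [|m IH]; first by rewrite perm1.
by rewrite expgSr permM -IH fix_i.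
Qed.

Lemma all_tlist_neq r : all (fun t => t.1 != t.2) (tlist r).
Proof. by apply/allP => t; exact: tlist_neq. Qed.

(** Started at the identity the algorithm only merges, so the accumulator stays 1 and the invariant
    gives the product. *)
Lemma sectorE_prod r : E r = \prod_(t <- tlist r) omega_ t.1 t.2.
Proof.
have [lr /fold_Fstep_merging[x1 p1]] := tlistP r.
have [_ _] := fold_Fstep 1 (all_tlist_neq r).
by rewrite x1 p1 lr deltaA1 expr1n sectorE1 !mulr1.
Qed.

Lemma positive_sectorE r : positive (E r).
Proof.
rewrite sectorE_prod; have := all_tlist_neq r.
elim: (tlist r) => [_|t l IH /= /andP[tt /IH ?]]; first by rewrite big_nil; exact: positive1.
by rewrite big_cons; apply: positiveM => //; exact: positive_copairing.
Qed.

Lemma sectorEV s : E s^-1 = E s.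
Proof.
apply/ffunP=> a; rewrite [LHS]ffunE [RHS]ffunE.
by rewrite (eq_push (porbitV s)).
Qed.

(** * Structure elements and their identities *)

Definition Ffactor r s : A := Ffac one dual N r s.

Lemma positive_Ffactor r s : positive (Ffactor r s).
Proof. by case: (fold_Fstep s (all_tlist_neq r)). Qed.

Lemma Ffactor_sqr r s : E (pcomp r s) * Ffactor r s ^+ 2 = E r * E s.
Proof.
have [pE _] := fold_Fstep s (all_tlist_neq r).
by rewrite pE -sectorE_prod lmulE (proj1 (tlistP r)).
Qed.

(** This is the structure element [G(r,s)]. *)
Definition pants r s : A := E (pcomp r s) * Ffactor r s.

Lemma positive_pants r s : positive (pants r s).
Proof. by apply: positiveM; [exact: positive_sectorE | exact: positive_Ffactor]. Qed.

Lemma pants_sqr r s : pants r s ^+ 2 = E r * E s * E (pcomp r s).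
Proof. by rewrite -Ffactor_sqr /pants; ring. Qed.

Lemma pantsP r s y : positive y -> y ^+ 2 = E r * E s * E (pcomp r s) ->
  y = pants r s.
Proof.
by move=> py yE; apply: positive_sqr_inj => //; [exact: positive_pants | rewrite yE pants_sqr].
Qed.

(** The square of the structure element has the factor [E r], and a self-dual element annihilates
    whatever its square annihilates. *)
Lemma pants_absorbl r s x y : E r * x = E r * y -> pants r s * x = pants r s * y.
Proof.
move=> h; apply/subr0_eq; rewrite -mulrBr; apply: positive_sqr_absorb.
  by case: (positive_pants r s).
by rewrite pants_sqr; exact: mul_absorb.
Qed.

Lemma pants_absorbr r s x y : E s * x = E s * y -> pants r s * x = pants r s * y.
Proof.
move=> h; apply/subr0_eq; rewrite -mulrBr; apply: positive_sqr_absorb.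
  by case: (positive_pants r s).
by rewrite pants_sqr; exact: mul_absorbr.
Qed.

(** By [Ffactor_sqr] both squares equal [E r * E s * E t * E (pcomp r (pcomp s t))]. *)
Lemma pants_assoc r s t :
  pants (pcomp r s) t * Ffactor r s = pants r (pcomp s t) * Ffactor s t.
Proof.
apply: positive_sqr_inj.
- by apply: positiveM; [exact: positive_pants | exact: positive_Ffactor].
- by apply: positiveM; [exact: positive_pants | exact: positive_Ffactor].
rewrite exprMn [RHS]exprMn !pants_sqr.
have -> : pcomp (pcomp r s) t = pcomp r (pcomp s t).
  by rewrite /pcomp mulgA.
exact: mul_sqr_assoc (Ffactor_sqr r s) (Ffactor_sqr s t).
Qed.

Lemma pants1l s : pants 1 s = E s.
Proof.
apply/esym/pantsP; first exact: positive_sectorE.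
by rewrite sectorE1 /pcomp mulg1; ring.
Qed.

Lemma pants1r s : pants s 1 = E s.
Proof.
apply/esym/pantsP; first exact: positive_sectorE.
by rewrite sectorE1 /pcomp mul1g; ring.
Qed.

Lemma pantsV r s : pants s^-1 r^-1 = pants r s.
Proof.
apply: pantsP; first exact: positive_pants.
rewrite pants_sqr; have -> : pcomp s^-1%g r^-1%g = (pcomp r s)^-1%g by rewrite /pcomp invMg.
rewrite (sectorEV r) (sectorEV s) (sectorEV (pcomp r s)).
by move: (E r) (E s) (E (pcomp r s)) => u v w; ring.
Qed.

Lemma pants_inv r : pants r r^-1 = E r.
Proof.
apply/esym/pantsP; first exact: positive_sectorE.
by rewrite (sectorEV r) /pcomp mulVg sectorE1; ring.
Qed.

(* [perm_layers r] extends [permT r] linearly. *)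
Definition perm_layers r : A -> A := push (fun k : 'I_n => r k).

Lemma perm_layersK r x : perm_layers r (perm_layers r^-1 x) = x.
Proof.
rewrite /perm_layers push_comp -[RHS]push_id; apply: eq_push => k /=.
exact: permKV.
Qed.

(** Layers [k] and [r k] share an orbit of [r], so multiplying along orbits does not see the
    permutation. *)
Lemma sectorE_perm_layers r x : E r * perm_layers r x = E r * x.
Proof.
apply/copush_eq; rewrite /perm_layers push_comp; apply: eq_push => k /=.
by apply/eqP; rewrite eq_porbit_mem -{1}[r]expg1 mem_porbit.
Qed.

Lemma psi_conj s r x :
  psi (s ^ r)%g (perm_layers r x) = push (fun O : {set 'I_n} => r @: O) (psi s x).
Proof.
by rewrite /psi /perm_layers !push_comp; apply: eq_push => k /=; rewrite porbitJ.
Qed.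

Lemma sectorE_conj s r : E (s ^ r)%g = perm_layers r (E s).
Proof.
apply: eq_basis_counit => a; rewrite -[basis _ a](perm_layersK r).
set y := perm_layers _ _; rewrite counit_copush -/(psi _ _) psi_conj.
rewrite counit_push_bij; last exact/imset_inj/perm_inj.
rewrite -counit_copush -(counit_push_bij _ (@perm_inj _ r)).
by rewrite rmorphM.
Qed.

(** Conjugation translates [E s] by [r], which is invisible next to the factor [E r]. In
    right-to-left composition [s ^ r] reads [r s r^-1]. *)
Lemma pants_conj r s : pants (s ^ r)%g r = pants r s.
Proof.
have conjE : pcomp (s ^ r)%g r = pcomp r s by rewrite /pcomp conjgE !mulgA mulgV mul1g.
apply: pantsP; first exact: positive_pants.
rewrite pants_sqr conjE sectorE_conj.
have := sectorE_perm_layers r (E s); move: (E r) (E s) (E (pcomp r s)) (perm_layers r (E s)).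
by move=> v w z u vu; transitivity (v * u * z); [ring | rewrite vu].
Qed.

End DefectSectors.

(** * Confinement *)

Section Confinement.
Variables (I : finType) (one : I) (dual : I -> I) (N : I -> I -> I -> nat).
Variable HN : mtc_fusion_rules one dual N.
Variable n : nat.
Local Notation C := (fusion_ring HN).
Local Notation Ten J := (fusion_ring (tensor_rules HN J)).
Local Notation T := {ffun 'I_n -> I}.
Local Notation A := (Ten 'I_n).
Local Notation e := (basis HN).
Local Notation E := (sectorE HN).
Implicit Types (r s : {perm 'I_n}) (x y : A) (a b c : T).

Lemma NseqE (l : seq I) (c : I) : Nseq one N l c = (\prod_(a <- l) e a) c :> int.
Proof.
elim: l c => [|a l IH] c; first by rewrite big_nil -basis1 basisE.
rewrite big_cons mul_basisE /= (big_morph Posz PoszD (erefl _)).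
by apply: eq_bigr => b _; rewrite PoszM IH mulrC.
Qed.

Lemma fixedP s b : reflect (forall k, b (s k) = b k) (fixedb s b).
Proof. by apply: (iffP forallP) => h k; apply/eqP; exact: h. Qed.

Lemma fixed_porbit s b k l : fixedb s b -> l \in porbit s k -> b l = b k.
Proof.
move=> /fixedP bs /porbitP[m ->].
by elim: m => [|m IH]; rewrite ?perm1 // expgSr permM bs.
Qed.

Lemma orbval_porbit s b k : fixedb s b -> orbval one b (porbit s k) = b k.
Proof.
move=> bs; rewrite /orbval; case: pickP => [l /= lk|/(_ k)].
  exact: fixed_porbit lk.
by rewrite porbit_id.
Qed.

(* The labels of the orbits of [s], as a labelling of all subsets of layers. *)
Definition spread s b : {ffun {set 'I_n} -> I} :=
  [ffun O => if O \in porbits s then orbval one b O else one].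

Lemma spread_porbit s b k : fixedb s b -> spread s b (porbit s k) = b k.
Proof. by move=> bs; rewrite ffunE imset_f // orbval_porbit. Qed.

Lemma spread_out s b O : O \notin porbits s -> spread s b O = one.
Proof. by rewrite ffunE => /negPf ->. Qed.

Lemma spread_inj s b c : fixedb s b -> fixedb s c -> spread s b = spread s c -> b = c.
Proof.
move=> bs cs h; apply/ffunP=> k.
by rewrite -(spread_porbit k bs) -(spread_porbit k cs) h.
Qed.

Lemma prod_porbit s a O : O \in porbits s ->
  \prod_(k | porbit s k == O) e (a k) = \prod_(x <- [seq a k | k <- enum O]) e x.
Proof.
case/imsetP=> l _ ->; rewrite big_map big_enum /=.
by apply: eq_bigl => k; rewrite eq_porbit_mem.
Qed.

(** Subsets that are not orbits have empty fibres and label [one], so they contribute the factor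
    1. *)
Lemma confE s x b : conf one N s x b = if fixedb s b then psi s x (spread s b) else 0.
Proof.
rewrite ffunE; case: ifP => // bs; rewrite pushE; apply: eq_bigr => a _.
congr (_ * _); rewrite PoszM_prod [RHS](bigID (mem (porbits s))) /=.
rewrite [X in _ * X]big1 ?mulr1 => [|O Os].
  apply: eq_bigr => O Os; rewrite NseqE prod_porbit //; congr (_ _).
  by rewrite ffunE Os.
rewrite spread_out // big_pred0 => [|k].
  by rewrite fusion_oneE eqxx.
by apply/eqP=> kO; rewrite -kO imset_f in Os.
Qed.

(** In the second case [psi] vanishes at [c], so [psi] is determined by its values at spreads of
    fixed labels. *)
Lemma spreadP s (c : {ffun {set 'I_n} -> I}) :
  (exists2 b, fixedb s b & c = spread s b) \/
  (exists2 O, O \notin porbits s & c O != one).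
Proof.
have [/forallP c1|] := boolP [forall O, (O \notin porbits s) ==> (c O == one)].
  left; exists [ffun k => c (porbit s k)].
    apply/fixedP => k; rewrite !ffunE; congr (c _); apply/eqP.
    by rewrite eq_porbit_mem -{1}[s]expg1 mem_porbit.
  apply/ffunP=> O; case: (boolP (O \in porbits s)) => [|Os]; last first.
    by rewrite spread_out //; apply/eqP; exact: (implyP (c1 O)).
  case/imsetP=> k _ ->; rewrite spread_porbit ?ffunE //.
  apply/fixedP => l; rewrite !ffunE; congr (c _); apply/eqP.
  by rewrite eq_porbit_mem -{1}[s]expg1 mem_porbit.
rewrite negb_forall => /existsP[O]; rewrite negb_imply => /andP[Os cO].
by right; exists O.
Qed.

Lemma psi_out s x (c : {ffun {set 'I_n} -> I}) O :
  O \notin porbits s -> c O != one -> psi s x c = 0.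
Proof.
move=> Os cO; rewrite pushE big1 // => a _; rewrite (bigD1 O) //= big_pred0 => [|k].
  by rewrite fusion_oneE (negPf cO) mul0r mulr0.
by apply/eqP=> kO; rewrite -kO imset_f in Os.
Qed.

(** Confinement and [psi s] carry the same information, and [psi s] has the same kernel as
    multiplication by [E s]. *)
Lemma conf_eq s x y : conf one N s x = conf one N s y <-> E s * x = E s * y.
Proof.
split=> [h|/copush_eq h]; last by apply/ffunP=> b; rewrite !confE /psi h.
apply/copush_eq/ffunP=> c; case: (spreadP s c) => [[b bs ->]|[O Os cO]].
  by move/ffunP/(_ b): h; rewrite !confE bs.
by rewrite -!/(psi _ _) (psi_out x Os cO) (psi_out y Os cO).
Qed.

Lemma psi_deconf s x b : fixedb s b -> conf one N s x = deltaA b ->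
  psi s x = basis (tensor_rules HN {set 'I_n}) (spread s b).
Proof.
move=> bs xb; apply/ffunP=> c; rewrite basisE.
case: (spreadP s c) => [[a fa ->]|[O Os cO]].
  move/ffunP/(_ a): xb; rewrite confE fa ffunE => ->; congr (nat_of_bool _)%:Z.
  by apply/eqP/eqP => [->//|]; exact: spread_inj.
rewrite (psi_out x Os cO) [_ == _](_ : _ = false) //.
by apply: contraNF cO => /eqP ->; rewrite spread_out.
Qed.

Lemma fixedb_vec1 s : fixedb s (vec1 one n).
Proof. by apply/fixedP => k; rewrite !ffunE. Qed.

Lemma mulR_unit s (z : {ffun T -> int}) :
  (forall b, ~~ fixedb s b -> z b = 0) -> mulR one N s z (deltaA (vec1 one n)) = z.
Proof.
move=> zs; apply/ffunP=> c; rewrite ffunE; case: ifPn => cs; last by rewrite zs.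
have fix1 := fixedb_vec1 s.
rewrite (bigD1 c) //= [X in _ + X]big1 => [|b /andP[bs bc]].
  rewrite addr0 (bigD1 (vec1 one n)) //= [X in _ + X]big1 => [|b /andP[_ b1]].
    rewrite addr0 ffunE eqxx mulr1 big1 ?mulr1 // => O /imsetP[k _ ->].
    by rewrite !orbval_porbit // ffunE (fusionC HN) (fusion1 HN) eqxx.
  by rewrite ffunE (negPf b1) mulr0 mul0r.
apply: big1 => f _; rewrite ffunE; case: eqP => [->|_]; last by rewrite mulr0 mul0r.
(* A label other than [c] differs from it at some layer, whose orbit gives a zero factor. *)
rewrite mulr1; case: (boolP [exists k, b k != c k]) => [/existsP[k bk]|].
  rewrite (bigD1 (porbit s k)) ?imset_f //= !orbval_porbit // ffunE.
  by rewrite (fusionC HN) (fusion1 HN) (negPf bk) mul0n mulr0.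
rewrite negb_exists => /forallP h; case/eqP: bc; apply/ffunP => k.
by apply/eqP; rewrite -[_ == _]negbK; exact: h.
Qed.

Lemma actAD_unit s x : actAD one N s x (deltaA (vec1 one n)) = conf one N s x.
Proof.
rewrite /actAD mulR_unit // => b bs.
by rewrite confE (negPf bs).
Qed.

Lemma spread_vec1 s : spread s (vec1 one n) = tensor_one one {set 'I_n}.
Proof.
apply/ffunP=> O; rewrite [RHS]ffunE; case: (boolP (O \in porbits s)) => Os.
  by case/imsetP: Os => k _ ->; rewrite spread_porbit ?fixedb_vec1 // ffunE.
exact: spread_out.
Qed.

Lemma conf_one s : conf one N s (1 : A) = deltaA (vec1 one n).
Proof.
apply/ffunP=> b; rewrite confE ffunE; case: ifPn => bs.
  rewrite /psi rmorph1 fusion_oneE -(spread_vec1 s); congr (nat_of_bool _)%:Z.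
  by apply/eqP/eqP => [|->//]; apply: spread_inj => //; exact: fixedb_vec1.
by case: eqP bs => // ->; rewrite fixedb_vec1.
Qed.

Lemma conf_vec1 s x : conf one N s x (vec1 one n) = counit (E s * x).
Proof. by rewrite confE fixedb_vec1 counit_copush spread_vec1. Qed.

Definition dual_label b : T := [ffun k => dual (b k)].

Lemma dual_labelK : involutive dual_label.
Proof. by move=> b; apply/ffunP=> k; rewrite !ffunE (dualK HN). Qed.

Lemma fixed_dual s b : fixedb s (dual_label b) = fixedb s b.
Proof.
apply/fixedP/fixedP => h k; move: (h k); rewrite !ffunE; last by move->.
exact: (inv_inj (dualK HN)).
Qed.

Lemma spread_dual s b : fixedb s b ->
  spread s (dual_label b) = tensor_dual dual (spread s b).
Proof.
move=> bs; apply/ffunP=> O; rewrite [RHS]ffunE; case: (boolP (O \in porbits s)) => Os.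
  by case/imsetP: Os => k _ ->; rewrite !spread_porbit ?fixed_dual // ffunE.
by rewrite !spread_out // (dual_one HN).
Qed.

Lemma conf_star s x b : conf one N s (star x) b = conf one N s x (dual_label b).
Proof.
rewrite !confE fixed_dual; case: ifP => // bs.
by rewrite /psi push_star starE spread_dual.
Qed.

Lemma spreadV s b : spread s^-1 b = spread s b.
Proof. by apply/ffunP=> O; rewrite !ffunE porbitsV. Qed.

Lemma fixedbV s b : fixedb s^-1 b = fixedb s b.
Proof.
apply/fixedP/fixedP => h k; last by rewrite -{2}[k](permKV s) h.
by rewrite -{2}[k](permK s) h.
Qed.

Lemma psiV s x : psi s^-1 x = psi s x.
Proof. by rewrite /psi (eq_push (porbitV s)). Qed.

Lemma confV s x : conf one N s^-1 x = conf one N s x.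
Proof. by apply/ffunP=> b; rewrite !confE fixedbV psiV spreadV. Qed.

Lemma conf_conj s r x b :
  conf one N (s ^ r)%g (perm_layers r x) b = conf one N s x [ffun k => b (r k)].
Proof.
rewrite !confE; set b' := finfun _.
have sr k : (s ^ r)%g (r k) = r (s k) by rewrite permJ.
have fixE : fixedb (s ^ r)%g b = fixedb s b'.
  apply/fixedP/fixedP => h k; first by rewrite !ffunE -sr h.
  by move: (h (r^-1 k)%g); rewrite !ffunE -sr permKV.
rewrite fixE; case: ifP => // bs; rewrite psi_conj push_bijE; last exact/imset_inj/perm_inj.
congr (psi _ _ _); apply/ffunP=> O; rewrite ffunE.
case: (boolP (O \in porbits s)) => Os.
  by case/imsetP: Os => k _ ->; rewrite -porbitJ !spread_porbit // ?fixE // ffunE.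
rewrite !spread_out //; apply: contra Os => /imsetP[k _].
rewrite -[k](permKV r) porbitJ => /(imset_inj (@perm_inj _ r)) ->.
exact: imset_f.
Qed.

Lemma conf_ge0 s x : (forall a, 0 <= x a) -> forall b, 0 <= conf one N s x b.
Proof.
move=> x0 b; rewrite ffunE; case: ifP => // _.
by apply: sumr_ge0 => a _; rewrite mulr_ge0.
Qed.

Lemma fusion_mul_ge0 x y :
  (forall a, 0 <= x a) -> (forall a, 0 <= y a) -> forall a, 0 <= (x * y) a.
Proof.
move=> x0 y0 a; rewrite mulE; apply: sumr_ge0 => b _; apply: sumr_ge0 => c _.
by rewrite !mulr_ge0.
Qed.

Lemma Ffactor_ge0 r s a : 0 <= Ffactor HN r s a.
Proof.
rewrite /Ffactor /Ffac; elim: (tlist r) a => [|[i j] l IH] a /=.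
  by rewrite ffunE.
move: IH; case: (foldr _ _ l) => x p /= IH; case: ifP => // _.
apply: fusion_mul_ge0 => // b; rewrite ffunE; exact: sumr_ge0.
Qed.

End Confinement.

(** * The product of defects *)

Lemma ffun_subE (K : finType) (M : zmodType) (f g : {ffun K -> M}) x :
  (f - g) x = f x - g x.
Proof. by rewrite !ffunE. Qed.

Section FusionRingOfDefects.
Variables (I : finType) (one : I) (dual : I -> I) (N : I -> I -> I -> nat).
Variable HN : mtc_fusion_rules one dual N.
Variable n : nat.
Local Notation T := {ffun 'I_n -> I}.
Local Notation A := (fusion_ring (tensor_rules HN 'I_n)).
Local Notation E := (sectorE HN).
Local Notation V := (V I n).
Local Notation B := (B I n).
Variable D : {perm 'I_n} -> T -> {ffun T -> int}.
Hypothesis HD : deconf_choice one N D.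
Local Notation mul := (mulV one dual N D).
Implicit Types (r s : {perm 'I_n}) (a b c : T) (w : A) (u v : V) (x y z : B).

(* [embed s (conf s w)] is the product of the anyons [w] with [X^s_1]. *)
Definition defect s w : V := embed s (conf one N s w).

Definition lift x : A := D (val x).1 (val x).2.

Lemma defectE s w x :
  defect s w x = if (val x).1 == s then conf one N s w (val x).2 else 0.
Proof. by rewrite ffunE. Qed.

Lemma defect_is_zmod_morphism s : zmod_morphism (defect s).
Proof.
move=> w w'; apply/ffunP=> x; rewrite ffun_subE !defectE.
case: eqP => _; rewrite ?subrr // !confE; case: ifP => _; rewrite ?subrr //.
by rewrite /psi raddfB /= fusion_subE.
Qed.
HB.instance Definition _ s := GRing.isZmodMorphism.Build A V (defect s)
  (defect_is_zmod_morphism s).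

Lemma defect_eq s w w' : E s * w = E s * w' -> defect s w = defect s w'.
Proof. by move=> /conf_eq h; apply/ffunP=> x; rewrite !defectE h. Qed.

Lemma conf_lift x : conf one N (val x).1 (lift x) = deltaA (val x).2.
Proof. by rewrite -actAD_unit; case: (HD (valP x)). Qed.

Lemma bv_defect x : bv x = defect (val x).1 (lift x).
Proof.
apply/ffunP=> y; rewrite defectE conf_lift ffunE -val_eqE.
case: (val y) (val x) => [s b] [r a]; rewrite /= xpair_eqE.
by case: eqP => //= _; rewrite ffunE.
Qed.

(** The chosen deconfinements, extended linearly, give a section of [defect s] over the sector of
    [s]. *)
Definition lift_sector s v : A := \sum_(x : B | (val x).1 == s) lift x *~ v x.

Lemma defect_lift_sector s v x :
  defect s (lift_sector s v) x = if (val x).1 == s then v x else 0.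
Proof.
rewrite raddf_sum /= sum_ffunE; case: eqP => [xs|/eqP xs]; last first.
  apply: big1 => y /eqP ys; rewrite raddfMz ffunMzE /= defectE (negPf xs).
  exact: mul0rz.
rewrite (bigD1 x) /= ?xs // big1 ?addr0 => [|y /andP[/eqP ys yx]].
  by rewrite raddfMz ffunMzE /= -xs -bv_defect ffunE eqxx intz.
by rewrite raddfMz ffunMzE /= -ys -bv_defect ffunE eq_sym (negPf yx) mul0rz.
Qed.

Lemma lift_sector_defect s w : E s * lift_sector s (defect s w) = E s * w.
Proof.
apply/conf_eq/ffunP=> b; case: (boolP (fixedb s b)) => [bs|/negPf bs]; last first.
  by rewrite !confE bs.
pose x : B := exist (fun p : {perm 'I_n} * T => fixedb p.1 p.2) (s, b) bs.
have := defect_lift_sector s (defect s w) x.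
by rewrite !defectE /= eqxx.
Qed.

Lemma mulB_defect x y : mulB one dual N D x y =
  defect (pcomp (val x).1 (val y).1)
    (lift x * lift y * Ffactor HN (val x).1 (val y).1).
Proof. by rewrite /mulB (actAD_unit (HN := HN)). Qed.

Lemma mul_Ffactor r s w : E (pcomp r s) * (w * Ffactor HN r s) = pants HN r s * w.
Proof. by rewrite /pants [w * _]mulrC mulrA. Qed.

(** This is independence of the deconfinements: the lifts agree with [w] and [w'] after
    multiplication by [E r] and [E s], and the structure element absorbs the difference. *)
Lemma mul_defect r s w w' :
  mul (defect r w) (defect s w') = defect (pcomp r s) (w * w' * Ffactor HN r s).
Proof.
transitivity (defect (pcomp r s) (lift_sector r (defect r w)
    * lift_sector s (defect s w') * Ffactor HN r s)); last first.
  apply: defect_eq; rewrite [LHS]mul_Ffactor [RHS]mul_Ffactor !mulrA.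
  have h1 := pants_absorbl s (lift_sector_defect r w).
  have h2 := pants_absorbr r (lift_sector_defect s w').
  move: h1 h2; move: (pants HN r s) (lift_sector r _) (lift_sector s _).
  by move=> p l l' h1 h2; rewrite h1 mulrAC h2 mulrAC.
rewrite /lift_sector !mulr_suml raddf_sum /mulV big_mkcond [RHS]big_mkcond.
apply: eq_bigr => x _ /=; rewrite defectE; case: eqP => [xr|xr]; last first.
  by rewrite big1 // => y _; rewrite mul0r mulr0z.
rewrite mulr_sumr mulr_suml raddf_sum [RHS]big_mkcond.
apply: eq_bigr => y _ /=; rewrite defectE; case: eqP => [ys|ys]; last first.
  by rewrite mulr0 mulr0z.
rewrite mulB_defect xr ys !(mulrzAl, mulrzAr) !raddfMz /= mulrzA.
exact: mulrzAC.
Qed.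

(** * Bilinearity, reduction to defects and the ring axioms *)

Lemma mulVDl u v v' : mul (u + v) v' = mul u v' + mul v v'.
Proof.
rewrite /mulV -big_split; apply: eq_bigr => x _ /=; rewrite -big_split.
by apply: eq_bigr => y _; rewrite ffunE mulrDl mulrzDr.
Qed.

Lemma mulVDr u v v' : mul u (v + v') = mul u v + mul u v'.
Proof.
rewrite /mulV -big_split; apply: eq_bigr => x _ /=; rewrite -big_split.
by apply: eq_bigr => y _; rewrite ffunE mulrDr mulrzDr.
Qed.

Lemma mulVBl u v v' : mul (u - v) v' = mul u v' - mul v v'.
Proof. by apply: (addIr (mul v v')); rewrite -mulVDl !subrK. Qed.

Lemma mulVBr u v v' : mul u (v - v') = mul u v - mul u v'.
Proof. by apply: (addIr (mul u v')); rewrite -mulVDr !subrK. Qed.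

Lemma starVB (st : B -> B) u v : starV st (u - v) = starV st u - starV st v.
Proof. by apply/ffunP=> x; rewrite !ffunE. Qed.

Lemma actVB r u v : actV r (u - v) = actV r u - actV r v.
Proof.
apply/ffunP=> x; rewrite ffun_subE !ffunE /coef.
by case: insub => [y|]; rewrite ?subrr // ffun_subE.
Qed.

(** Closure under subtraction suffices: 0 is a defect, whence negation and addition follow, and
    integer multiples of basis vectors are again defects. *)
Lemma defect_ind (P : V -> Prop) :
  (forall u v, P u -> P v -> P (u - v)) -> (forall s w, P (defect s w)) ->
  forall u, P u.
Proof.
move=> PB Pd u.
have P0 : P 0 by have := Pd 1%g 0; rewrite raddf0.
have PN v : P v -> P (- v) by move=> Pv; rewrite -[- v]add0r; exact: PB.
have PD v v' : P v -> P v' -> P (v + v').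
  by move=> Pv /PN Pv'; rewrite -[v']opprK; exact: PB.
have -> : u = \sum_(x : B) bv x *~ u x.
  apply/ffunP=> x; rewrite sum_ffunE (bigD1 x) //= big1 ?addr0 => [|y yx].
    by rewrite ffunMzE ffunE eqxx intz.
  by rewrite ffunMzE ffunE eq_sym (negPf yx) mul0rz.
elim/big_rec: _ => // x v _; apply: PD; rewrite bv_defect -raddfMz; exact: Pd.
Qed.

Lemma mulVA u v v' : mul (mul u v) v' = mul u (mul v v').
Proof.
elim/defect_ind: u => [u1 u2 h1 h2|r w]; first by rewrite !mulVBl h1 h2.
elim/defect_ind: v => [u1 u2 h1 h2|s w']; first by rewrite !(mulVBl, mulVBr) h1 h2.
elim/defect_ind: v' => [u1 u2 h1 h2|t w'']; first by rewrite !mulVBr h1 h2.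
rewrite !mul_defect.
have -> : pcomp (pcomp r s) t = pcomp r (pcomp s t) by rewrite /pcomp mulgA.
apply: defect_eq.
have := pants_assoc HN r s t; rewrite /pants.
have -> : pcomp (pcomp r s) t = pcomp r (pcomp s t) by rewrite /pcomp mulgA.
move: (E _) (Ffactor HN (pcomp r s) t) (Ffactor HN r s) (Ffactor HN r (pcomp s t)) (Ffactor HN s t).
move=> e f1 f2 g1 g2 h.
transitivity (e * f1 * f2 * (w * w' * w'')); first by ring.
by rewrite h; ring.
Qed.

Lemma fixedb_unit : fixedb (1%g : {perm 'I_n}) (vec1 one n).
Proof. exact: fixedb_vec1. Qed.

Definition unit_label : B :=
  exist (fun p : {perm 'I_n} * T => fixedb p.1 p.2) (1%g, vec1 one n) fixedb_unit.

Lemma bv_unit : bv unit_label = defect 1%g 1.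
Proof.
rewrite bv_defect; apply: defect_eq; apply/conf_eq.
by rewrite conf_one; exact: (conf_lift unit_label).
Qed.

Lemma mul1V u : mul (bv unit_label) u = u.
Proof.
elim/defect_ind: u => [u v hu hv|s w]; first by rewrite mulVBr hu hv.
rewrite bv_unit mul_defect; have sE : pcomp 1%g s = s by rewrite /pcomp mulg1.
have := mul_Ffactor 1%g s (1 * w); rewrite pants1l mul1r sE; exact: defect_eq.
Qed.

Lemma mulV1 u : mul u (bv unit_label) = u.
Proof.
elim/defect_ind: u => [u v hu hv|s w]; first by rewrite mulVBl hu hv.
rewrite bv_unit mul_defect; have sE : pcomp s 1%g = s by rewrite /pcomp mul1g.
have := mul_Ffactor s 1%g (w * 1); rewrite pants1r mulr1 sE; exact: defect_eq.
Qed.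

Lemma mul_bv_ge0 x y z : 0 <= mul (bv x) (bv y) z.
Proof.
rewrite !bv_defect mul_defect defectE; case: ifP => // _.
have lift_ge0 x' a : 0 <= lift x' a by case: (HD (valP x')).
apply: conf_ge0 => a; apply: fusion_mul_ge0; last exact: Ffactor_ge0.
exact: fusion_mul_ge0.
Qed.

(** * Duality and crossed commutativity *)

Lemma fixed_star x : fixedb (val x).1^-1%g (dual_label dual (val x).2).
Proof. by rewrite fixedbV (fixed_dual HN); exact: (valP x). Qed.

Definition star_label x : B :=
  exist (fun p : {perm 'I_n} * T => fixedb p.1 p.2)
    ((val x).1^-1%g, dual_label dual (val x).2) (fixed_star x).

Lemma star_labelK : involutive star_label.
Proof.
by move=> x; apply: val_inj; rewrite /= invgK (dual_labelK HN); case: (val x).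
Qed.

Lemma starV_defect s w : starV star_label (defect s w) = defect s^-1%g (star w).
Proof.
apply/ffunP=> x; rewrite ffunE !defectE confV conf_star /=.
by rewrite -(inj_eq invg_inj) invgK.
Qed.

(** After multiplication by the sector element this becomes [pantsV], since [F] is self-dual. *)
Lemma starVM u v :
  starV star_label (mul u v) = mul (starV star_label v) (starV star_label u).
Proof.
elim/defect_ind: u => [u1 u2 h1 h2|r w].
  by rewrite mulVBl !starVB mulVBr h1 h2.
elim/defect_ind: v => [u1 u2 h1 h2|s w'].
  by rewrite mulVBr !starVB mulVBl h1 h2.
rewrite !(mul_defect, starV_defect).
have -> : pcomp s^-1%g r^-1%g = (pcomp r s)^-1%g by rewrite /pcomp invMg.
apply: defect_eq.
have := pantsV HN r s; rewrite /pants.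
have -> : pcomp s^-1%g r^-1%g = (pcomp r s)^-1%g by rewrite /pcomp invMg.
rewrite sectorEV !rmorphM /= (proj1 (positive_Ffactor HN r s)).
move: (E _) (Ffactor HN r s) (Ffactor HN s^-1 r^-1) (star w) (star w').
move=> e f g z z' h; transitivity (e * f * (z * z')); first by ring.
by rewrite -h; ring.
Qed.

(** Only [s = r^-1] reaches the sector of the unit. There the structure element is [E r], and the
    coefficient becomes the pairing of the two orbit labels under [psi r]. *)
Lemma mul_unit_coef x y : mul (bv x) (bv y) unit_label = (x == star_label y)%:Z.
Proof.
rewrite !bv_defect mul_defect defectE -[in RHS]val_eqE.
have := conf_lift x; have := conf_lift y; move: (lift x) (lift y).
case: x y => [[r a] /= ar] [[s b] /= bs] w w' hw' hw; rewrite /= xpair_eqE.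
have -> : (1%g == pcomp r s) = (r == s^-1%g).
  by rewrite [LHS]eq_sym [RHS]eq_sym eq_invg_mul.
case: eqP => //= rs; rewrite conf_vec1 mul_Ffactor.
have -> : pants HN r s = E r by rewrite -[s]invgK -rs pants_inv.
rewrite counit_copush rmorphM /=.
have -> : push (porbit r) w = basis _ (spread one r a) by exact: psi_deconf.
have br : fixedb r b by rewrite rs fixedbV.
have -> : push (porbit r) w' = basis _ (spread one r b).
  by apply: psi_deconf => //; rewrite rs confV.
rewrite counit_basis_mul basisE -(spread_dual HN ar); congr (nat_of_bool _)%:Z.
apply/eqP/eqP => [/spread_inj <-|->]; rewrite ?(dual_labelK HN) ?(fixed_dual HN) //.
Qed.

Lemma actV_defect r s w : actV r (defect s w) = defect (s ^ r)%g (perm_layers r w).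
Proof.
apply/ffunP=> x; rewrite ffunE defectE conf_conj /coef.
have -> : pcomp r^-1%g (pcomp (val x).1 r) = ((val x).1 ^ r^-1)%g.
  by rewrite /pcomp conjgE invgK mulgA.
have -> : permT r^-1%g (val x).2 = [ffun k => (val x).2 (r k)].
  by apply/ffunP=> k; rewrite !ffunE invgK.
have -> : ((val x).1 == s ^ r)%g = ((val x).1 ^ r^-1 == s)%g.
  by apply/eqP/eqP => [->|<-]; rewrite ?conjgK ?conjgKV.
(* At a label that is not fixed, the default 0 of [coef] matches the value 0 of [conf]. *)
case: insubP => [y _ yE|/= nfix]; first by rewrite defectE yE.
by case: eqP nfix => // -> /negPf; rewrite confE => ->.
Qed.

(** The structure elements agree by [pants_conj], and they absorb the permutation of layers through
    [E r]. *)
Lemma mul_crossed x u : mul (bv x) u = mul (actV (val x).1 u) (bv x).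
Proof.
rewrite bv_defect; move: (val x).1 (lift x) => r w.
elim/defect_ind: u => [u v hu hv|s w'].
  by rewrite mulVBr actVB mulVBl hu hv.
rewrite actV_defect !mul_defect.
have pE : pcomp (s ^ r)%g r = pcomp r s by rewrite /pcomp conjgE !mulgA mulgV mul1g.
have := mul_Ffactor (s ^ r)%g r (perm_layers r w' * w); rewrite pE pants_conj => h.
apply: defect_eq; rewrite [LHS]mul_Ffactor [RHS]h.
have := pants_absorbl s (sectorE_perm_layers r w').
move: (pants HN r s) (perm_layers r w') => p z hz.
by rewrite mulrA [RHS]mulrA hz mulrAC.
Qed.

End FusionRingOfDefects.

Unset Implicit Arguments.

Theorem theorem4p19
  (I : finType) (one : I) (dual : I -> I) (N : I -> I -> I -> nat)
  (HN : mtc_fusion_rules one dual N)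
  (n : nat) (Hn : (2 <= n)%N)
  (D : {perm 'I_n} -> {ffun 'I_n -> I} -> {ffun {ffun 'I_n -> I} -> int})
  (HD : deconf_choice one N D) :
  let mul := mulV one dual N D in
  (* ring axioms: associativity, distributivity, unit X^id_1 *)
  (forall u v w, mul (mul u v) w = mul u (mul v w)) /\
  (forall u v w, mul u (v + w) = mul u v + mul u w) /\
  (forall u v w, mul (u + v) w = mul u w + mul v w) /\
  (exists x1 : B I n,
     val x1 = (1%g, vec1 one n) /\
     (forall u, mul (bv x1) u = u) /\ (forall u, mul u (bv x1) = u) /\
  (* based Z_+-ring: nonnegative structure constants *)
     (forall x y z, 0 <= mul (bv x) (bv y) z) /\
  (* involution of the basis inducing an anti-involution, with the
     unit-coefficient condition *)
     (exists st : B I n -> B I n,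
        (forall x, st (st x) = x) /\
        (forall u v, starV st (mul u v) = mul (starV st v) (starV st u)) /\
        (forall x y, mul (bv x) (bv y) x1 = (x == st y)%:Z))) /\
  (* S_n-crossed commutativity *)
  (forall (x : B I n) (Y : V I n),
     mul (bv x) Y = mul (actV (val x).1 Y) (bv x)).
Proof.
move=> mul; split; first exact: (mulVA HN HD).
split; first by move=> u v w; exact: mulVDr.
split; first by move=> u v w; exact: mulVDl.
split; last exact: (mul_crossed HN HD).
exists (unit_label one n); split; first by [].
split; first exact: (mul1V HN HD).
split; first exact: (mulV1 HN HD).
split; first exact: (mul_bv_ge0 HN HD).
exists (star_label HN (n:=n)); split; first exact: star_labelK.
split; first exact: (starVM HN HD).
exact: (mul_unit_coef HN HD).
Qed.
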